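(* Let $n,d>0$ be fixed integers. Put $n_0=n$ and, for $i\ge 0$, $g_i=\gcd(n_i,d)$ and $n_{i+1}=n_i/g_i$. Let $k\ge 0$ be the smallest integer with $g_k=1$, and let $m=n_k$ (so $\gcd(m,d)=1$ and $n_{k+1}=m$). For $v\in\mathbb{Z}_m$ let $O'(v)$ be the orbit of $v$ under the permutation $x\mapsto -dx$ of $\mathbb{Z}_m$, and let $o'(v)=|O'(v)|$. For a prime $p\mid m$ let $\pi_p(m)$ be the largest power of $p$ dividing $m$. Let $V'$ be a complete set of representatives of the orbits $O'(v)$ on $\mathbb{Z}_m\setminus\{0\}$, chosen so that for every prime $p\mid m$ all integers of the form $m/p^j$ with $j\ge 1$ and $p^j\mid m$ (viewed in $\mathbb{Z}_m$) belong to $V'$. Then the sandpile group (equivalently, critical group) of the generalized Kautz graph $\mathrm{Kautz}(n,d)$ satisfies $$S_{\mathrm{Kautz}}(n,d)\cong \Bigl[\bigoplus_{i=0}^{k-1}\Bigl(\mathbb{Z}_{d^{i+1}/g_i}\oplus\mathbb{Z}_{d^{i+1}}^{\,n_i-2n_{i+1}+n_{i+2}-1}\Bigr)\Bigr]\oplus\Bigl[\bigoplus_{v\in V'}\mathbb{Z}_{(d^{o'(v)}-1)/c'(v)}\Bigr],$$ where $c'(v)=1$ except in the following cases. For any prime $p\mid m$, $$c'(m/\pi_p(m))=\begin{cases}\pi_p(m), & \text{if } p\ne 2 \text{ or } -d\equiv 1 \bmod 4 \text{ or } 4\nmid m,\\ \pi_2(m)/2, & \text{if } p=2 \text{ and }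 -d\equiv 3\bmod 4 \text{ (that is, } d\equiv 1\bmod 4) \text{ and } 4\mid m,\end{cases}$$ and if $4\mid m$ and $-d\equiv 3\bmod 4$ (that is, $d\equiv 1\bmod 4$), then $c'(m/2)=2$.
   Context: $\mathbb{Z}_r$ denotes the cyclic group (ring) of integers modulo $r$; empty direct sums are trivial. The generalized Kautz graph $\mathrm{Kautz}(n,d)$ is the directed multigraph with vertex set $\mathbb{Z}_n$ and directed edges $v\to -d(v+1)+i$ for $i=0,\ldots,d-1$ and all $v\in\mathbb{Z}_n$ (counted with multiplicity, loops allowed). For a directed multigraph $G$ on $n$ vertices, the adjacency matrix $A$ has entry $A_{v,w}$ equal to the number of edges from $v$ to $w$; the Laplacian is $\Delta=D-A$ with $D$ diagonal and $D_{v,v}$ the indegree of $v$. The critical group of $G$ is the finite part (torsion subgroup) of $\mathbb{Z}^n/R$, where $R$ is the $\mathbb{Z}$-span of the rows of $\Delta$. The sandpile group of $G$ at $v$ is the finite part of the analogous quotient of $\mathbb{Z}^{n-1}$ for the reduced Laplacian, obtained from $\Delta$ by deleting the row and column indexed by $v$; for Eulerian $G$ (indegree equals outdegree at every vertex, as is the case for $\mathrm{Kautz}(n,d)$) it does not depend on $v$ and equals the critical group.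
   Formalization: The order (d^{o'(v)}-1)/c'(v) is corrected to |(-d)^{o'(v)}-1|/c'(v), which differs only when o'(v) is odd, where the printed formula fails (n=2, d=3 has group Z_2, not 0); for d=1 a summand Z_0 is read as its finite part, the trivial group. *)

(* Defs.v *)
From HB Require Import structures.
From mathcomp Require Import all_boot all_order all_algebra.
From mathcomp Require Import boolp.
Set Implicit Arguments.
Unset Strict Implicit.
Unset Printing Implicit Defensive.
Import GRing.Theory.
Local Open Scope ring_scope.

Definition zmod_isomorphic (U V : zmodType) : Prop :=
  exists f : {additive U -> V}, bijective f.

Definition torsion (U : zmodType) : {pred U} :=
  fun x => `[< exists2 r : nat, (0 < r)%N & x *+ r = 0 >].

Lemma torsion_zmod_closed (U : zmodType) : zmod_closed (@torsion U).
Proof.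
split=> [|x y /asboolP[r r0 xr] /asboolP[s s0 ys]]; apply/asboolP.
  by exists 1%N.
exists (r * s)%N; first by rewrite muln_gt0 r0.
by rewrite mulrnBl mulrnA xr mul0rn mulnC mulrnA ys mul0rn subrr.
Qed.

HB.instance Definition _ (U : zmodType) :=
  GRing.isZmodClosed.Build U (@torsion U) (@torsion_zmod_closed U).

Record finite_part (U : zmodType) :=
  FinitePart { finite_part_val : U; _ : finite_part_val \in @torsion U }.

HB.instance Definition _ (U : zmodType) :=
  [isSub for @finite_part_val U].
HB.instance Definition _ (U : zmodType) := [Choice of finite_part U by <:].
HB.instance Definition _ (U : zmodType) :=
  [SubChoice_isSubZmodule of finite_part U by <:].

Definition row_lattice (m n : nat) (L : 'M[int]_(m, n)) : {pred 'rV[int]_n} :=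
  fun x => `[< exists c : 'rV[int]_m, x = c *m L >].

Lemma row_lattice_zmod_closed (m n : nat) (L : 'M[int]_(m, n)) :
  zmod_closed (row_lattice L).
Proof.
split=> [|x y /asboolP[a ->] /asboolP[b ->]]; apply/asboolP.
  by exists 0; rewrite mul0mx.
by exists (a - b); rewrite mulmxBl.
Qed.

HB.instance Definition _ (m n : nat) (L : 'M[int]_(m, n)) :=
  GRing.isZmodClosed.Build 'rV[int]_n (row_lattice L)
    (row_lattice_zmod_closed L).

Definition coker (m n : nat) (L : 'M[int]_(m, n)) : zmodType :=
  Quotient.quot (row_lattice L).

(* A v w is the number of edges from v to w. *)
Definition multigraph (n : nat) := 'M[nat]_n.

Definition indegree (n : nat) (A : multigraph n) (v : 'I_n) : nat :=
  (\sum_(u < n) A u v)%N.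

Definition laplacian (n : nat) (A : multigraph n) : 'M[int]_n :=
  \matrix_(v, w) ((if v == w then (indegree A v)%:Z else 0) - (A v w)%:Z).

Definition critical_group (n : nat) (A : multigraph n) : zmodType :=
  finite_part (coker (laplacian A)).

Definition reduced_laplacian (n : nat) (A : multigraph n) (v : 'I_n) :
  'M[int]_n.-1 := row' v (col' v (laplacian A)).

Definition sandpile_group (n : nat) (A : multigraph n) (v : 'I_n) : zmodType :=
  finite_part (coker (reduced_laplacian A v)).

Definition kautz (n d : nat) : multigraph n :=
  \matrix_(v, w)
    #|[set i : 'I_d | (w == - d%:Z * (v%:Z + 1) + i%:Z %[mod n])%Z]|.

Fixpoint kautz_n (n d i : nat) : nat :=
  if i is j.+1 then (kautz_n n d j %/ gcdn (kautz_n n d j) d)%N else n.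

Definition kautz_g (n d i : nat) : nat := gcdn (kautz_n n d i) d.

(* The map x |-> - d * x on Z_m, with Z_m identified with {0, ..., m - 1}; the
   default x of insubd is never used, since the residue is always below m. *)
Definition mulNd (d m : nat) (x : 'I_m) : 'I_m :=
  insubd x `|(- d%:Z * x%:Z %% m)%Z|%N.

Definition orbit_representatives (d m : nat) (V : {set 'I_m}) : Prop :=
  (forall v : 'I_m, v \in V -> (v : nat) <> 0%N) /\
  (forall x : 'I_m, (x : nat) <> 0%N ->
     exists! v : 'I_m, v \in V /\ v \in orbit (@mulNd d m) x).

Definition contains_prime_power_quotients (m : nat) (V : {set 'I_m}) : Prop :=
  forall p j : nat, prime p -> (0 < j)%N -> (p ^ j %| m)%N ->
    exists2 v : 'I_m, v \in V & (v : nat) = (m %/ p ^ j)%N.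

(* Here m`_p is the largest power of p dividing m. The two branches never
   overlap: m %/ 2 = m %/ m`_p would force m`_p = 2, excluded by 4 %| m. *)
Definition kautz_c (d m v : nat) : nat :=
  (if [&& 4 %| m, (- d%:Z == 3 %[mod 4])%Z & v == m %/ 2] then 2
   else if [seq p : nat <- primes m | v == m %/ m`_p] is p :: _ then
     if [|| p != 2, (- d%:Z == 1 %[mod 4])%Z | ~~ (4 %| m)] then m`_p
     else m`_2 %/ 2
   else 1)%N.

(* |(-d)^o - 1| = d^o - (-1)^o, where o is the size of the orbit of v. The source
   has d^o - 1 here, a sign slip when o is odd. For n = 3 and d = 2 the graph is
   the complete digraph on 3 vertices, with critical group Z_3; both orbits {1}
   and {2} have size 1, and the factors are Z_((2+1)/3) and Z_(2+1), whereas
   d^o - 1 would yield the meaningless index (2-1)/3 and the trivial Z_(2-1). *)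
Definition kautz_orbit_order (d m : nat) (v : 'I_m) : nat :=
  (`|((- d%:Z) ^+ fingraph.order (@mulNd d m) v - 1)%R| %/ kautz_c d m v)%N.

(* The direct sum of the groups Z_r for r in s, with Z_r realized as 'I_r under
   addition modulo r ('Z_r would be Z/2 when r = 1). An index r = 0 occurs only
   for d = 1; the trivial group it yields here is the finite part of Z/0Z. *)
Definition sum_Z (s : seq nat) : zmodType :=
  foldr (fun r (G : zmodType) => ('I_r.-1.+1 * G)%type : zmodType)
    ('I_1 : zmodType) s.

Definition kautz_orders (n d k : nat) (V : {set 'I_(kautz_n n d k)}) :
    seq nat :=
  let n_ := kautz_n n d in let g_ := kautz_g n d in
  flatten [seq (d ^ i.+1 %/ g_ i)%N
                 :: nseq (n_ i + n_ i.+2 - (2 * n_ i.+1 + 1)) (d ^ i.+1)%N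
          | i <- iota 0 k]
  ++ [seq kautz_orbit_order d v | v <- enum V].

(* Main.v *)
From HB Require Import structures.
Require Import Defs.
From mathcomp Require Import all_boot all_order all_algebra.
From mathcomp Require Import boolp zify ring generic_quotient.

(** Why the theorem holds.

    Identify Z^n with the group ring Z[x]/(x^n - 1), the vertex v being the
    monomial x^v. The row of the Laplacian at v is
    d x^v - x^(-dv-d) (1 + x + ... + x^(d-1)). Multiplication by x - 1 makes the
    geometric sum telescope and turns this row into (d + phi)(x^(v+1) - x^v),
    where phi is the linear map x^v |-> x^(-dv). Let
      G = < e_v, v in Z_n | e_0 = 0, e_(-dv) = - d e_v >.
    Multiplication by x - 1 then identifies the vectors of coordinate sum 0
    modulo the Laplacian with the kernel of the map G -> Z_n, e_v |-> v, called
    the weight here ([kautz_decomposition]). Both groups of the theorem are the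
    torsion part of this kernel.

    The group G is read off from the map tau : v |-> -dv on Z_n. Its cycles are
    the orbits on the stable image, a copy of Z_m, and a cycle of length o gives
    a cyclic summand of order |(-d)^o - 1|. The trees hanging on the cycles give
    summands of d-power order: choose a section s of tau that always picks a
    preimage lying as deep as possible in the images of the iterates of tau.
    A vertex y in the image of tau^i but not of tau^(i+1), with y <> s (tau y),
    yields e_(s^i y) - e_(s^(i+1) (tau y)), which has order d^(i+1). There are
    n_i - 2 n_(i+1) + n_(i+2) such y ([card_top]). These elements generate G by
    induction along the chains, and explicit linear functionals show that they
    are independent ([initial_decomposition]).

    The kernel of the weight is reached through subgroups M' of M with M / M'
    cyclic, generated by the class of a single generator f_0 of M. Correcting
    the other generators by multiples of f_0 leads to a decomposition of M' in
    which only the order of f_0 changes: it is divided by the order of M / M'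
    ([decomposition_step], [weight_step]). The corrections must not increase
    orders. For the p-part of Z_m one takes f_0 = e_v for v = m / p^a with
    p^a the exact power of p in m, and lifting the exponent gives the required
    comparison of orders ([orbit_exponent_local]). This produces the factors c'.
    When p = 2, 4 divides m and -d = 3 mod 4, lifting the exponent fails for
    odd powers of -d, and the step is split in two: first a quotient of order
    2^(a-1) with the same f_0, then one of order 2 with f_0 = e_(m/2). For the
    part of Z_n supported on the primes dividing d one descends through the
    quotients of order g_(k-1), ..., g_0; for the one of order g_i the generator
    f_0 has order d^(i+1), which explains the summands of order d^(i+1) / g_i
    ([full_order_generator], [level_stages]). *)

Set Implicit Arguments.
Unset Strict Implicit.
Unset Printing Implicit Defensive.
Import GRing.Theory Num.Theory.

(** * Cyclic decompositions of subquotients *)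

Section Decompositions.
Local Open Scope ring_scope.

Definition subgroup (A : zmodType) (P : A -> Prop) : Prop :=
  P 0 /\ forall x y, P x -> P y -> P (x - y).

Section SubgroupTheory.
Variables (A : zmodType) (P : A -> Prop) (sgP : subgroup P).

Lemma subgroup0 : P 0. Proof. by case: sgP. Qed.

Lemma subgroupB x y : P x -> P y -> P (x - y).
Proof. by case: sgP => _; apply. Qed.

Lemma subgroupN x : P x -> P (- x).
Proof. by rewrite -[- x]sub0r; apply/subgroupB/subgroup0. Qed.

Lemma subgroupD x y : P x -> P y -> P (x + y).
Proof. by move=> Px /subgroupN Py; rewrite -[y]opprK; apply: subgroupB. Qed.

Lemma subgroupMz x (z : int) : P x -> P (x *~ z).
Proof.
move=> Px; have Pn (j : nat) : P (x *+ j).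
  by elim: j => [|j IH]; [exact: subgroup0 | rewrite mulrS; apply: subgroupD].
by case: z => j; [apply: Pn | rewrite NegzE mulrNz; apply/subgroupN/Pn].
Qed.

Lemma subgroup_sum (T : Type) (s : seq T) (B : pred T) (F : T -> A) :
  (forall t, B t -> P (F t)) -> P (\sum_(t <- s | B t) F t).
Proof.
move=> PF; elim/big_ind: _ => //; [exact: subgroup0 | exact: subgroupD].
Qed.

End SubgroupTheory.

(** The quotient (M + L) / L is the direct sum of the cyclic groups generated by
    the classes of the f_t for t in B, that of f_t being of order r_t. The order
    0 stands for an infinite cyclic summand, which lets d = 1 be treated like
    every other d. Working with subgroups of A rather than with quotient types
    allows M to shrink while A, L and B stay the same. *)
Definition decomposes (A : zmodType) (M L : A -> Prop) (T : finType)
    (B : pred T) (f : T -> A) (r : T -> nat) : Prop :=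
  [/\ forall t, B t -> M (f t),
      forall x, M x ->
        exists a : T -> int, L (x - \sum_(t | B t) f t *~ a t)
    & forall a : T -> int, L (\sum_(t | B t) f t *~ a t) <->
        forall t, B t -> (r t %| a t)%Z].

Lemma decomposition_dvd (A : zmodType) (M L : A -> Prop) (T : finType)
    (B : pred T) (f : T -> A) (r : T -> nat) t :
  decomposes M L B f r -> B t -> L (f t *+ r t).
Proof.
case=> _ _ rel Bt.
have /rel : forall u, B u -> (r u %| (if u == t then (r t)%:Z else 0))%Z.
  by move=> u _; case: eqP => [->|_]; rewrite ?dvdzz ?dvdz0.
rewrite (bigD1 t) //= eqxx big1 ?addr0 // => u /andP[_ /negPf->].
by rewrite mulr0z.
Qed.

(** Here M / M' is cyclic of order c, generated by the class of f_t0. Subtracting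
    suitable multiples of f_t0 moves the other generators into M'; divisibility
    of r_t * a_t by r_t0 makes r_t kill the corrected generators as well. *)
Lemma decomposition_step (A : zmodType) (M M' L : A -> Prop) (T : finType)
    (B : pred T) (f : T -> A) (r : T -> nat) (t0 : T) (c : nat)
    (a : T -> int) :
  subgroup M' -> (forall x, L x -> M' x) -> (forall x, M' x -> M x) ->
  B t0 -> (0 < c)%N -> (forall z, M' (f t0 *~ z) <-> (c %| z)%Z) ->
  (forall t, B t -> t != t0 -> M' (f t - f t0 *~ a t)) ->
  (forall t, B t -> t != t0 -> (r t0 %| (r t)%:Z * a t)%Z) ->
  decomposes M L B f r ->
  decomposes M' L B
    (fun t => if t == t0 then f t0 *+ c else f t - f t0 *~ a t)
    (fun t => if t == t0 then r t0 %/ c else r t)%N.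
Proof.
move=> sgM' LM' MM' Bt0 c0 Mt0 Ma ra dec; have [Mf gen rel] := dec.
set f' := fun t => if _ then _ else _.
have Mf' t : B t -> M' (f' t).
  rewrite /f'; case: eqVneq => [_ _|ne Bt]; last exact: Ma.
  by apply/(Mt0 c); rewrite dvdzz.
have sumE (b : T -> int) : \sum_(t | B t) f' t *~ b t =
    \sum_(t | B t) f t *~ (if t == t0 then
      b t0 *+ c - \sum_(u | B u && (u != t0)) a u * b u else b t).
  rewrite (bigD1 t0) // [RHS](bigD1 t0) //= /f' eqxx.
  rewrite mulrzBr mulrz_sumr -addrA; congr (_ + _).
    by rewrite pmulrn -mulrzA -mulr_natl natz.
  rewrite addrC -sumrB; apply: eq_bigr => t /andP[_ /negPf->].
  by rewrite mulrzBl -mulrzA.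
have crt0 : (c %| (r t0)%:Z)%Z.
  by apply/Mt0/LM'; rewrite -pmulrn; apply: decomposition_dvd dec Bt0.
split=> // [x Mx|b].
  have [b Lb] := gen _ (MM' _ Mx).
  pose z := b t0 + \sum_(u | B u && (u != t0)) a u * b u.
  have xE : x - \sum_(t | B t) f t *~ b t =
    x - (\sum_(t | B t && (t != t0)) f' t *~ b t + f t0 *~ z).
    congr (x - _); rewrite (bigD1 t0) //=.
    have -> : \sum_(t | B t && (t != t0)) f' t *~ b t =
        \sum_(t | B t && (t != t0)) f t *~ b t -
        f t0 *~ (\sum_(t | B t && (t != t0)) a t * b t).
      rewrite mulrz_sumr -sumrB; apply: eq_bigr => t /andP[_ /negPf ne].
      by rewrite /f' ne mulrzBl -mulrzA.
    by rewrite /z mulrzDr [f t0 *~ b t0 + _]addrC addrA subrK addrC.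
  have /Mt0/dvdzP[y zE] : M' (f t0 *~ z).
    have -> : f t0 *~ z = x - \sum_(t | B t && (t != t0)) f' t *~ b t
       - (x - \sum_(t | B t) f t *~ b t).
      by rewrite xE opprB !addrA subrK addrAC subrr add0r.
    apply: subgroupB => //; last exact: LM'.
    apply: subgroupB => //; apply: subgroup_sum => // t /andP[Bt _].
    by apply: subgroupMz => //; apply: Mf'.
  exists (fun t => if t == t0 then y else b t).
  rewrite (bigD1 t0) //= eqxx {1}/f' eqxx pmulrn -mulrzA mulrC -zE addrC.
  under eq_bigr => t /andP[_ /negPf->] do [].
  by move: Lb; rewrite xE.
have ra_sum : (forall t, B t -> t != t0 -> (r t %| b t)%Z) ->
    (r t0 %| \sum_(u | B u && (u != t0)) a u * b u)%Z.
  move=> rb; apply: rpred_sum => u /andP[Bu ne].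
  have /dvdzP[w ->] := rb u Bu ne.
  by rewrite mulrCA dvdz_mull // mulrC ra.
have rbt0 : (forall t, B t -> t != t0 -> (r t %| b t)%Z) ->
    (r t0 %| b t0 *+ c - \sum_(u | B u && (u != t0)) a u * b u)%Z =
    ((r t0 %/ c)%N %| b t0)%Z.
  move=> /ra_sum H; rewrite rpredBr //.
  have /dvdnP[y ->] : (c %| r t0)%N by [].
  by rewrite mulnK // -mulr_natr natz !dvdzE abszM !absz_nat dvdn_pmul2r.
rewrite sumE rel; split=> H.
  have H' t : B t -> t != t0 -> (r t %| b t)%Z.
    by move=> Bt ne; move: (H t Bt); rewrite (negPf ne).
  move=> t Bt; move: (H t Bt); case: eqVneq => // -> .
  by rewrite rbt0.
have H' t : B t -> t != t0 -> (r t %| b t)%Z.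
  by move=> Bt ne; move: (H t Bt); rewrite (negPf ne).
by move=> t Bt; move: (H t Bt); case: eqVneq => // ->; rewrite rbt0.
Qed.

Section DirectSum.
Variables (U : zmodType) (T : finType) (B : pred T) (f : T -> U) (r : T -> nat).

Fixpoint sum_Z_combination (ts : seq T) : sum_Z (map r ts) -> U :=
  if ts is t :: ts' then fun x => f t *+ x.1 + sum_Z_combination x.2
  else fun=> 0.

Variable M : U -> Prop.
Hypothesis dec : decomposes M (fun x => x = 0) B f r.

Let rf0 t : B t -> f t *+ r t = 0.
Proof. exact: decomposition_dvd dec. Qed.

Let f_modn t (j : nat) : B t ->
  f t *+ (j %% (r t).-1.+1) = if r t == 0%N then 0 else f t *+ j.
Proof.
move=> Bt; case: eqVneq => [->|r0]; first by rewrite modn1.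
rewrite prednK ?lt0n // {2}(divn_eq j (r t)) mulrnDr mulnC mulrnA rf0 //.
by rewrite mul0rn add0r.
Qed.

Lemma sum_Z_combinationD ts : all B ts ->
  {morph @sum_Z_combination ts : x y / x + y}.
Proof.
elim: ts => [_ x y|t ts IH /= /andP[Bt Bts] x y] /=; first by rewrite addr0.
rewrite IH // addrACA -mulrnDr; congr (_ + _).
rewrite f_modn //; case: eqVneq => // rt0.
by have h (i : 'I_(r t).-1.+1) : i = 0%N :> nat; rewrite ?h //; move: i;
  rewrite rt0 => i; rewrite ord1.
Qed.

Lemma sum_Z_combination_coef ts : uniq ts ->
  forall x : sum_Z (map r ts), exists2 a : T -> int,
    sum_Z_combination x = \sum_(t <- ts) f t *~ a t
    & (forall t, t \in ts -> (r t %| a t)%Z) -> x = 0.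
Proof.
elim: ts => [_ x|t ts IH /= /andP[tts uts] [i x]] /=.
  by exists (fun=> 0) => [|_]; [rewrite big_nil | exact: ord1].
have [a aE ax] := IH uts x.
exists (fun u => if u == t then (i : nat)%:Z else a u).
  rewrite big_cons eqxx aE; congr (_ + _); apply: eq_big_seq => u uts'.
  by case: eqP uts' tts => // -> ->.
move=> ra; congr pair.
  have ri : (r t %| i)%N by have := ra t (mem_head _ _); rewrite eqxx.
  apply: val_inj => /=; move: (i : nat) (ltn_ord i) ri => j.
  have [->|r0] := posnP (r t); first by rewrite ltnS leqn0 => /eqP.
  by rewrite prednK // => lt_jr; rewrite /dvdn modn_small // => /eqP.
apply: ax => u uts'; have := ra u; rewrite inE uts' orbT => /(_ isT).
by case: eqP uts' tts => // -> ->.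
Qed.

Lemma sum_Z_combination_onto ts (a : T -> int) : all B ts ->
  (forall t, t \in ts -> r t = 0%N -> a t = 0) ->
  exists x : sum_Z (map r ts), sum_Z_combination x = \sum_(t <- ts) f t *~ a t.
Proof.
elim: ts => [_ _|t ts IH /= /andP[Bt Bts] a0].
  by exists 0; rewrite big_nil.
have [|x xE] := IH Bts; first by move=> u uts; apply: a0; rewrite inE uts orbT.
exists (inord `|(a t %% r t)%Z|, x); rewrite /= big_cons xE; congr (_ + _).
have [r0|r0] := posnP (r t).
  by rewrite a0 ?mem_head // mod0z inordK // mulr0z.
have rne : (r t)%:Z != 0 by rewrite eqz_nat -lt0n.
rewrite inordK ?prednK // -?ltz_nat ?gez0_abs ?modz_ge0 ?ltz_pmod //.
rewrite [in RHS](divz_eq (a t) (r t)) mulrzDr mulrC mulrzA -pmulrn rf0 // mul0rz.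
by rewrite add0r pmulrn gez0_abs ?modz_ge0.
Qed.

Lemma sum_Z_combination_torsion ts (x : sum_Z (map r ts)) : all B ts ->
  sum_Z_combination x \in @torsion U.
Proof.
elim: ts x => [x _|t ts IH [i x] /= /andP[Bt Bts]]; first exact: rpred0.
apply: rpredD; last exact: IH.
have [r0|r0] := posnP (r t).
  by have -> : i = 0%N :> nat; [move: i; rewrite r0 => i;
    rewrite ord1 | exact: rpred0].
by apply/asboolP; exists (r t) => //; rewrite -mulrnA mulnC mulrnA rf0 // mul0rn.
Qed.

(** A summand of order 0 contributes no torsion, and the matching factor of
    [sum_Z] is the trivial group 'I_1. The list ts fixes the order of the
    factors. *)
Lemma finite_part_decomposition ts :
  (forall x, x \in @torsion U -> M x) -> uniq ts -> ts =i B ->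
  zmod_isomorphic (finite_part U) (sum_Z (map r ts)).
Proof.
move=> torM uts tsB.
have Bts : all B ts by apply/allP => t; rewrite tsB.
have sumE (F : T -> U) : \sum_(t <- ts) F t = \sum_(t | B t) F t.
  by rewrite big_uniq //; apply: eq_bigl => t; rewrite tsB.
pose g (x : sum_Z (map r ts)) : finite_part U :=
  FinitePart (sum_Z_combination_torsion x Bts).
have gD : {morph g : x y / x + y}.
  by move=> x y; apply: val_inj; rewrite /= sum_Z_combinationD.
have gB : {morph g : x y / x - y}.
  by move=> x y; apply/eqP; rewrite eq_sym subr_eq -gD subrK.
have ginj : injective g.
  move=> x y gxy; apply/eqP; rewrite -subr_eq0; apply/eqP.
  have [a aE] := sum_Z_combination_coef uts (x - y); apply.
  have [_ _ rel] := dec; move=> t; rewrite tsB; move: t; apply/rel.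
  have := congr1 val (gB x y); rewrite gxy subrr /=.
  by rewrite aE sumE.
have gsurj (u : finite_part U) : exists x, g x = u.
  have [_ gen rel] := dec; case: u => u uT.
  have [a /eqP] := gen _ (torM u uT); rewrite subr_eq0 => /eqP uE.
  have [|x xE] := @sum_Z_combination_onto ts a Bts.
    move=> t; rewrite tsB => Bt rt0.
    have /asboolP[N N0 uN] := uT.
    have /rel/(_ t Bt) : \sum_(t | B t) f t *~ (a t * N) = 0.
      rewrite -[RHS]uN uE -sumrMnl; apply: eq_bigr => v _.
      by rewrite mulrzA pmulrn.
    rewrite rt0 dvd0z mulf_eq0 => /orP[/eqP //|].
    by rewrite eqz_nat => /eqP N0'; rewrite N0' in N0.
  by exists x; apply: val_inj; rewrite /= xE sumE uE.
have [h hK] := choice gsurj.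
have gK : cancel g h by move=> x; apply: ginj; rewrite hK.
have hB : zmod_morphism h.
  by move=> x y; apply: ginj; rewrite gB !hK.
pose hmor := GRing.isZmodMorphism.Build _ _ h hB.
pose H : {additive finite_part U -> sum_Z (map r ts)} := HB.pack h hmor.
by exists H; exists g.
Qed.

End DirectSum.

End Decompositions.

(** * Transport to cokernels of Laplacians *)

Section Transport.
Local Open Scope ring_scope.

(** If E identifies M' / L' with M / L, preimages of the generators modulo L
    decompose M' / L' with the same orders. *)
Lemma decomposition_preimage (A A' : zmodType) (E : {additive A' -> A})
    (M L : A -> Prop) (M' L' : A' -> Prop) (T : finType) (B : pred T)
    (f : T -> A) (r : T -> nat) :
  subgroup L -> subgroup M' -> (forall z, M' z -> M (E z)) ->
  (forall x, M x -> exists2 z, M' z & L (x - E z)) ->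
  (forall z, M' z -> (L' z <-> L (E z))) ->
  decomposes M L B f r -> exists f', decomposes M' L' B f' r.
Proof.
move=> sgL sgM' ME onto EL [Mf gen rel].
have [f' f'P] : {f' : T -> A' & forall t, B t -> M' (f' t) /\ L (f t - E (f' t))}.
  apply: (choice (P := fun t z => B t -> M' z /\ L (f t - E z))) => t.
  case: (boolP (B t)) => [Bt|_]; last by exists 0.
  by have [z Mz Lz] := onto _ (Mf t Bt); exists z.
have M'sum a : M' (\sum_(t | B t) f' t *~ a t).
  by apply: subgroup_sum => // t Bt; apply: subgroupMz => //; have [] := f'P t Bt.
have Lsum a : L (\sum_(t | B t) f t *~ a t - E (\sum_(t | B t) f' t *~ a t)).
  rewrite raddf_sum -sumrB; apply: subgroup_sum => // t Bt.
  by rewrite raddfMz -mulrzBl; apply: subgroupMz => //; have [] := f'P t Bt.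
exists f'; split=> [t Bt|z Mz|a]; first by have [] := f'P t Bt.
- have [a La] := gen _ (ME z Mz); exists a.
  apply/EL; first exact: subgroupB.
  rewrite raddfB -[E z](subrK (\sum_(t | B t) f t *~ a t)) -addrA.
  exact: subgroupD.
rewrite -rel EL //; split=> H.
  by rewrite -[X in L X](subrK (E (\sum_(t | B t) f' t *~ a t)));
    apply: subgroupD.
rewrite -[X in L X](subKr (\sum_(t | B t) f t *~ a t)).
exact: subgroupB.
Qed.

Lemma decomposition_image (A U : zmodType) (g : {additive A -> U})
    (M L : A -> Prop) (T : finType) (B : pred T) (f : T -> A) (r : T -> nat) :
  subgroup M -> (forall x, M x -> (L x <-> g x = 0)) ->
  decomposes M L B f r ->
  decomposes (fun u => exists2 x, M x & g x = u) (fun u => u = 0) B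
    (g \o f) r.
Proof.
move=> sgM Lg [Mf gen rel].
have Msum a : M (\sum_(t | B t) f t *~ a t).
  by apply: subgroup_sum => // t Bt; apply: subgroupMz => //; apply: Mf.
have sumE a : \sum_(t | B t) (g \o f) t *~ a t = g (\sum_(t | B t) f t *~ a t).
  by rewrite raddf_sum; apply: eq_bigr => t _; rewrite raddfMz.
split=> [t Bt|_ [x Mx <-]|a]; first by exists (f t); first exact: Mf.
  have [a La] := gen x Mx; exists a; rewrite sumE -raddfB.
  by apply/Lg => //; apply: subgroupB.
by rewrite sumE -rel -Lg.
Qed.

Definition coker_proj (m n : nat) (L : 'M[int]_(m, n)) (x : 'rV[int]_n) :
  coker L := \pi_(Quotient.quot (row_lattice L))%qT x.

Lemma coker_proj_zmod_morphism m n (L : 'M[int]_(m, n)) :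
  zmod_morphism (coker_proj L).
Proof. by move=> x y; rewrite /coker_proj raddfB. Qed.

HB.instance Definition _ m n (L : 'M[int]_(m, n)) :=
  GRing.isZmodMorphism.Build _ _ (coker_proj L) (coker_proj_zmod_morphism L).

Lemma coker_proj_eq0 m n (L : 'M[int]_(m, n)) x :
  coker_proj L x = 0 <-> exists c : 'rV_m, x = c *m L.
Proof.
rewrite -(raddf0 (coker_proj L)); split=> [/eqP|[c xE]].
  by rewrite /coker_proj -Quotient.idealrBE subr0 => /asboolP.
apply/eqP; rewrite /coker_proj -Quotient.idealrBE subr0; apply/asboolP.
by exists c.
Qed.

Lemma coker_proj_onto m n (L : 'M[int]_(m, n)) (u : coker L) :
  exists x, coker_proj L x = u.
Proof. by exists (repr u); rewrite /coker_proj reprK. Qed.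

End Transport.

Section Laplacians.
Local Open Scope ring_scope.

Definition coord_sum n (x : 'rV[int]_n) : int := \sum_v x 0 v.

Lemma coord_sum_zmod_morphism n : zmod_morphism (@coord_sum n).
Proof. by move=> x y; rewrite /coord_sum -sumrB; apply: eq_bigr => v _;
  rewrite !mxE. Qed.

HB.instance Definition _ n :=
  GRing.isZmodMorphism.Build _ _ (@coord_sum n) (@coord_sum_zmod_morphism n).

Lemma subgroup_coord_sum n : subgroup (fun x : 'rV[int]_n => coord_sum x = 0).
Proof. by split=> [|x y xE yE]; rewrite ?raddf0 // raddfB /= xE yE subrr. Qed.

Definition in_row_lattice m n (L : 'M[int]_(m, n)) (x : 'rV_n) : Prop :=
  exists c, x = c *m L.

(** The rows of the Laplacian have sum 0, hence so does every torsion class: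
    the vectors of sum 0 already carry the whole finite part. *)
Lemma critical_group_decomposition n (A : multigraph n) (T : finType)
    (B : pred T) (f : T -> 'rV[int]_n) (r : T -> nat) (ts : seq T) :
  (forall v, \sum_w laplacian A v w = 0) ->
  uniq ts -> ts =i B ->
  decomposes (fun x => coord_sum x = 0) (in_row_lattice (laplacian A)) B f r ->
  zmod_isomorphic (critical_group A) (sum_Z (map r ts)).
Proof.
move=> rowsum uts tsB dec.
have sum0 c : coord_sum (c *m laplacian A) = 0.
  rewrite /coord_sum; under eq_bigr do rewrite mxE.
  by rewrite exchange_big big1 // => v _; rewrite -mulr_sumr rowsum mulr0.
apply: (finite_part_decomposition (decomposition_image
  (g := coker_proj (laplacian A)) (@subgroup_coord_sum n) _ dec)) => //.
  by move=> x _; rewrite coker_proj_eq0.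
move=> u; have [x <-] := coker_proj_onto u.
case/asboolP=> N N0; rewrite -raddfMn => /coker_proj_eq0[c xE].
exists x => //; have := sum0 c; rewrite -xE raddfMn => /eqP.
by rewrite mulrn_eq0 eqn0Ngt N0 => /eqP.
Qed.

(** Forgetting the coordinate at v is a bijection from the vectors of sum 0 onto
    Z^(n-1). It matches the two row lattices because the rows of the Laplacian
    add up to 0, so that the row at v is redundant. *)
Lemma sandpile_group_decomposition n (A : multigraph n) (v : 'I_n) (T : finType)
    (B : pred T) (f : T -> 'rV[int]_n) (r : T -> nat) (ts : seq T) :
  (forall v, \sum_w laplacian A v w = 0) ->
  uniq ts -> ts =i B ->
  decomposes (fun x => coord_sum x = 0) (in_row_lattice (laplacian A)) B f r ->
  zmod_isomorphic (sandpile_group A v) (sum_Z (map r ts)).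
Proof.
move=> rowsum uts tsB dec.
have colsum w : \sum_u laplacian A u w = 0.
  under eq_bigr do rewrite mxE.
  rewrite sumrB -big_mkcond big_pred1_eq /indegree raddf_sum /=.
  by apply/eqP; rewrite subr_eq0.
have sum0 c : coord_sum (c *m laplacian A) = 0.
  rewrite /coord_sum; under eq_bigr do rewrite mxE.
  by rewrite exchange_big big1 // => u _; rewrite -mulr_sumr rowsum mulr0.
pose g := coker_proj (reduced_laplacian A v) \o col' v.
have coordE x : coord_sum x = x 0 v + \sum_j (col' v x) 0 j.
  by rewrite /coord_sum (bigD1_ord v) //=; congr (_ + _);
    apply: eq_bigr => j _; rewrite mxE.
have extE (y : 'rV_n.-1) : exists2 x : 'rV_n, coord_sum x = 0 & col' v x = y.
  pose x := \row_j (if unlift v j is Some i then y 0 i else - \sum_i y 0 i).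
  have xy : col' v x = y.
    by apply/rowP => i; rewrite !mxE liftK.
  by exists x => //; rewrite coordE xy mxE unlift_none addNr.
have col'0 x : coord_sum x = 0 -> col' v x = 0 -> x = 0.
  rewrite coordE => xs x0; move: xs; rewrite x0 big1 ?addr0 => [xv|i _];
    last by rewrite mxE.
  apply/rowP => j; rewrite mxE; case: (unliftP v j) => [i ->|-> //].
  by move/rowP/(_ i): x0; rewrite !mxE.
have col'M (c : 'rV_n) : c 0 v = 0 ->
    col' v (c *m laplacian A) = col' v c *m reduced_laplacian A v.
  move=> cv; apply/rowP => j; rewrite !mxE (bigD1_ord v) //= cv mul0r add0r.
  by apply: eq_bigr => i _; rewrite !mxE.
apply: (finite_part_decomposition (decomposition_image
  (g := g) (@subgroup_coord_sum n) _ dec)) => //.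
  move=> x xs; rewrite /g /= coker_proj_eq0; split=> [[c xE]|[c xE]].
    exists (col' v (c - const_mx (c 0 v))).
    rewrite -col'M ?mxE ?subrr // mulmxBl -xE.
    suff -> : (const_mx (c 0 v) : 'rV_n) *m laplacian A = 0 by rewrite subr0.
    apply/rowP => w; rewrite !mxE; under eq_bigr do rewrite mxE.
    by rewrite -mulr_sumr colsum mulr0.
  have [c' c's c'E] := extE c.
  pose c2 := c' - c' 0 v *: delta_mx 0 v.
  have c2E : col' v c2 = c.
    by rewrite -c'E; apply/rowP => i;
      rewrite !mxE eqxx eq_sym (negPf (neq_lift _ _)) mulr0 subr0.
  exists c2; apply/eqP; rewrite -subr_eq0; apply/eqP/col'0.
    by rewrite raddfB /= xs sum0 subrr.
  by rewrite raddfB /= col'M ?c2E ?xE ?subrr // !mxE !eqxx mulr1 subrr.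
move=> u _; have [y <-] := coker_proj_onto u.
by have [x xs xy] := extE y; exists x => //; rewrite /g /= xy.
Qed.

End Laplacians.

(** * The Kautz Laplacian as an endomorphism of the group ring *)

Section Residues.
Local Open Scope ring_scope.
Variables (n : nat) (n_gt0 : (0 < n)%N).

Lemma residue_subproof (z : int) : (`|(z %% n)%Z| < n)%N.
Proof.
have n0 : n%:Z != 0 by rewrite eqz_nat -lt0n.
by rewrite -ltz_nat gez0_abs ?modz_ge0 // ltz_pmod // ltz_nat.
Qed.

Definition int_residue (z : int) : 'I_n :=
  insubd (Ordinal n_gt0) `|(z %% n)%Z|%N.
Local Notation residue := int_residue.

Lemma val_residue z : (residue z : nat)%:Z = (z %% n)%Z.
Proof. by rewrite val_insubd residue_subproof gez0_abs ?modz_ge0 // eqz_nat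
  -lt0n. Qed.

Lemma residue_eq z w : (residue z == residue w) = (z == w %[mod n])%Z.
Proof. by rewrite -val_eqE -eqz_nat !val_residue. Qed.

Lemma residueP z w : (z = w %[mod n])%Z -> residue z = residue w.
Proof. by move/eqP; rewrite -residue_eq => /eqP. Qed.

Lemma residue_ord (v : 'I_n) : residue v = v.
Proof. by apply/val_inj;
  rewrite val_insubd residue_subproof modz_nat modn_small. Qed.

Lemma mulNd_residue d z : mulNd d (residue z) = residue (- d%:Z * z).
Proof.
rewrite /mulNd val_residue modzMmr.
by apply/val_inj; rewrite !val_insubd !residue_subproof.
Qed.

Lemma mulNdE d (v : 'I_n) : mulNd d v = residue (- d%:Z * (v : nat)%:Z).
Proof. by rewrite -{1}[v]residue_ord mulNd_residue. Qed.

Definition residue_vector (z : int) : 'rV[int]_n := delta_mx 0 (residue z).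
Local Notation point := residue_vector.

Definition functional (c : 'I_n -> int) (x : 'rV[int]_n) : int :=
  \sum_v x 0 v * c v.

Lemma functional_zmod_morphism c : zmod_morphism (functional c).
Proof.
move=> x y; rewrite /functional -sumrB.
by apply: eq_bigr => v _; rewrite !mxE mulrBl.
Qed.

HB.instance Definition _ c :=
  GRing.isZmodMorphism.Build _ _ (functional c) (functional_zmod_morphism c).

Lemma functional_delta c v : functional c (delta_mx 0 v) = c v.
Proof.
rewrite /functional (bigD1 v) //= mxE !eqxx mul1r big1 ?addr0 // => w /negPf wv.
by rewrite mxE wv andbF mul0r.
Qed.

Lemma functional_point c z : functional c (point z) = c (residue z).
Proof. exact: functional_delta. Qed.

Lemma functionalZ c a x : functional c (a *: x) = a * functional c x.
Proof. by rewrite /functional mulr_sumr; apply: eq_bigr => v _;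
  rewrite mxE mulrA. Qed.

Lemma row_sum_point (x : 'rV[int]_n) : x = \sum_v x 0 v *: point v.
Proof.
rewrite {1}[x]row_sum_delta; apply: eq_bigr => v _.
by rewrite /residue_vector residue_ord.
Qed.

Lemma coord_sumE x : coord_sum x = functional (fun=> 1) x.
Proof. by apply: eq_bigr => v _; rewrite mulr1. Qed.

End Residues.

Section KautzRelations.
Local Open Scope ring_scope.
Variables (n d : nat) (n_gt0 : (0 < n)%N).
Local Notation residue := (int_residue n_gt0).
Local Notation point := (residue_vector n_gt0).

(** The map phi : e_v |-> e_(-dv) of the introduction, acting on row vectors. *)
Definition mulNd_mx : 'M[int]_n := \matrix_(v, w) (w == mulNd d v)%:R.

(** Multiplication by x - 1 in Z[x]/(x^n - 1). *)
Definition shift_mx : 'M[int]_n :=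
  \matrix_(v, w) ((w == residue (v%:Z + 1))%:R - (w == v)%:R).

(** The relations of the group G of the introduction. Using all of Z^n for h,
    instead of the vectors of sum 0, only adds multiples of e_0. *)
Definition kautz_relation (x : 'rV[int]_n) : Prop :=
  exists h b, x = h *m (d%:R%:M + mulNd_mx) + b *: point 0.

Lemma point_mul z : point z *m mulNd_mx = point (- d%:Z * z).
Proof.
rewrite -rowE; apply/rowP => w; rewrite !mxE eqxx mulNd_residue.
by congr (nat_of_bool _)%:R.
Qed.

Lemma point_shift z : point z *m shift_mx = point (z + 1) - point z.
Proof.
rewrite -rowE; apply/rowP => w; rewrite !mxE !eqxx /=; congr (_%:R - _).
congr nat_of_bool; congr (_ == _); apply: residueP.
by rewrite val_residue modzDml.
Qed.

Lemma mulmx_point_sum (x : 'rV[int]_n) m (M : 'M_(n, m)) :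
  x *m M = \sum_v x 0 v *: (point v *m M).
Proof.
rewrite {1}[x](row_sum_point n_gt0) mulmx_suml.
by apply: eq_bigr => v _; rewrite -scalemxAl.
Qed.

Lemma subgroup_kautz_relation : subgroup kautz_relation.
Proof.
split=> [|_ _ [h [b ->]] [h' [b' ->]]].
  by exists 0, 0; rewrite mul0mx scale0r addr0.
by exists (h - h'), (b - b'); rewrite mulmxBl scalerBl opprD addrACA.
Qed.

Lemma kautz_relation_mul z :
  kautz_relation (point (- d%:Z * z) + d%:R *: point z).
Proof.
exists (point z), 0.
by rewrite scale0r addr0 mulmxDr point_mul mul_mx_scalar addrC.
Qed.

Lemma kautz_relation_point0 : kautz_relation (point 0).
Proof. by exists 0, 1; rewrite mul0mx scale1r add0r. Qed.

(** Functionals with values in Z / r on the group G: it is enough to check the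
    defining relations. *)
Lemma functional_kautz_relation (r : int) c x :
  (r %| c (residue 0))%Z ->
  (forall v, (r %| c (mulNd d v) + d%:R * c v)%Z) ->
  kautz_relation x -> (r %| functional c x)%Z.
Proof.
move=> r0 rc [h [b ->]]; rewrite raddfD /= functionalZ functional_point.
rewrite rpredD ?dvdz_mull // mulmx_point_sum raddf_sum /=.
apply: rpred_sum => v _; rewrite functionalZ dvdz_mull //.
rewrite mulmxDr mul_mx_scalar point_mul raddfD /= functionalZ !functional_point.
by rewrite addrC residue_ord -mulNdE.
Qed.

(** A lift to the integers of the map G -> Z_n, e_v |-> v. *)
Definition weight (x : 'rV[int]_n) : int := functional (fun v => (v : nat)%:Z) x.

HB.instance Definition _ :=
  GRing.isZmodMorphism.Build _ _ weight (functional_zmod_morphism _).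

Lemma weight_point z : (weight (point z) = z %[mod n])%Z.
Proof. by rewrite /weight functional_point val_residue modz_mod. Qed.

Lemma kautz_relation_weight x : kautz_relation x -> (n %| weight x)%Z.
Proof.
apply: functional_kautz_relation => [|v];
  first by rewrite val_residue mod0z dvdz0.
rewrite (mulNdE n_gt0) val_residue; apply/dvdz_mod0P; rewrite modzDml.
have -> : - d%:Z * v%:Z + d%:R * v%:Z = 0 by rewrite natz; ring.
by rewrite mod0z.
Qed.

Lemma mul_shift_coord (x : 'rV[int]_n) z :
  (x *m shift_mx) 0 (residue z) = x 0 (residue (z - 1)) - x 0 (residue z).
Proof.
rewrite !mxE; under eq_bigr do rewrite mxE mulrBr.
rewrite sumrB; congr (_ - _).
  rewrite (bigD1 (residue (z - 1))) //= val_residue.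
  rewrite residue_eq modzDml subrK eqxx mulr1 big1 ?addr0 // => v vz.
  rewrite residue_eq; case: eqP => [E|]; last by rewrite mulr0.
  case/eqP: vz; rewrite -[v](residue_ord n_gt0); apply: residueP.
  by apply/eqP; rewrite -(eqz_modDr 1) subrK; apply/eqP.
rewrite (bigD1 (residue z)) //= eqxx mulr1 big1 ?addr0 // => v /negPf vz.
by rewrite eq_sym vz mulr0.
Qed.

Lemma mul_shift_const (b : int) : (const_mx b : 'rV_n) *m shift_mx = 0.
Proof.
apply/rowP => w; rewrite -[w](residue_ord n_gt0) mul_shift_coord !mxE.
exact: subrr.
Qed.

Lemma mul_shift_eq0 (x : 'rV[int]_n) :
  x *m shift_mx = 0 -> x = const_mx (x 0 (residue 0)).
Proof.
move=> xS; have x0 (j : nat) : x 0 (residue j) = x 0 (residue 0).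
  elim: j => // j <-; have /esym/eqP := mul_shift_coord x j.+1.
  have -> : j.+1%:Z - 1 = j%:Z by lia.
  by rewrite xS mxE subr_eq0 => /eqP.
by apply/rowP => w; rewrite !mxE -[w in LHS](residue_ord n_gt0) x0.
Qed.

Lemma mul_shift_onto (x : 'rV[int]_n) :
  exists c, x - coord_sum x *: point 0 = c *m shift_mx.
Proof.
have pointP (j : nat) : exists c, point j - point 0 = c *m shift_mx.
  elim: j => [|j [c cE]]; first by exists 0; rewrite mul0mx subrr.
  exists (c + point j).
  have -> : j.+1%:Z = j%:Z + 1 by lia.
  by rewrite mulmxDl -cE point_shift [RHS]addrC subrKA.
have [c cP] := choice (fun v : 'I_n => pointP v).
exists (\sum_v x 0 v *: c v).
rewrite {1}[x](row_sum_point n_gt0) /coord_sum scaler_suml -sumrB mulmx_suml.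
by apply: eq_bigr => v _; rewrite -scalerBr cP scalemxAl.
Qed.

Lemma coord_sum_shift c : coord_sum (c *m shift_mx) = 0.
Proof.
rewrite mulmx_point_sum raddf_sum big1 // => v _ /=.
by rewrite coord_sumE functionalZ point_shift raddfB /= !functional_point subrr
  mulr0.
Qed.

Lemma coord_sum_mul h : coord_sum (h *m (d%:R%:M + mulNd_mx)) = d.+1%:R *
  coord_sum h.
Proof.
rewrite mulmx_point_sum raddf_sum /coord_sum mulr_sumr; apply: eq_bigr => v _.
rewrite /= coord_sumE functionalZ mulmxDr mul_mx_scalar point_mul raddfD /=.
by rewrite functionalZ !functional_point mulr1 natr1 mulrC.
Qed.

(** Each x^(v+1) - x^v has weight 1 modulo n; this is why the vectors of sum 0
    correspond to the kernel of the weight modulo n. *)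
Lemma weight_shift c : (n %| weight (c *m shift_mx) - coord_sum c)%Z.
Proof.
rewrite mulmx_point_sum raddf_sum /coord_sum -sumrB; apply: rpred_sum => v _.
rewrite /= /weight functionalZ point_shift -[X in _ - X]mulr1 -mulrBr dvdz_mull
  //.
rewrite raddfB /= !functional_point !val_residue.
have modE z : (n %| (z %% n)%Z - z)%Z by rewrite -eqz_mod_dvd modz_mod.
rewrite (_ : _ - 1 = ((v%:Z + 1) %% n)%Z - (v%:Z + 1) - ((v %% n)%Z - v%:Z)).
  exact: rpredB.
ring.
Qed.

Definition kautz_mx : 'M[int]_n := \matrix_(v, w) (kautz n d v w)%:Z.

Lemma row_kautz v :
  row v kautz_mx = \sum_(i < d) point (- d%:Z * (v%:Z + 1) + i%:Z).
Proof.
apply/rowP => w; rewrite !mxE summxE -[Posz #|_|]natz -sum1dep_card natr_sum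
  big_mkcond /=.
apply: eq_bigr => i _; rewrite mxE eqxx /= -residue_eq residue_ord.
by case: eqP.
Qed.

(** The sum over the d outgoing edges telescopes. *)
Lemma kautz_shift : kautz_mx *m shift_mx = - (shift_mx *m mulNd_mx).
Proof.
apply/row_matrixP => v; rewrite row_mul row_kautz mulmx_suml raddfN /= row_mul.
have -> : row v shift_mx = point (v%:Z + 1) - point v.
  by rewrite -point_shift /residue_vector residue_ord -rowE.
rewrite mulmxBl !point_mul opprB.
under eq_bigr do rewrite point_shift.
rewrite -(big_mkord xpredT (fun i => point (- d%:Z * (v%:Z + 1) + i%:Z + 1) -
  point (- d%:Z * (v%:Z + 1) + i%:Z))).
rewrite (telescope_sumr_eq (fun i : nat => point (- d%:Z * (v%:Z + 1) + i%:Z)))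
  //.
  by rewrite addr0; congr (point _ - _); ring.
by move=> i _; congr (point _ - _); lia.
Qed.

Lemma coord_sum_kautz c : coord_sum (c *m kautz_mx) = d%:R * coord_sum c.
Proof.
rewrite mulmx_point_sum raddf_sum /coord_sum mulr_sumr; apply: eq_bigr => v _.
rewrite /= coord_sumE functionalZ mulrC; congr (_ * _).
rewrite {1}/residue_vector residue_ord -rowE row_kautz raddf_sum /=.
by under eq_bigr do rewrite functional_point; rewrite sumr_const card_ord.
Qed.

(** By [kautz_shift] the vector of indegrees is killed by x - 1, hence constant,
    and the average indegree is the outdegree d. *)
Lemma indegree_kautz v : indegree (kautz n d) v = d.
Proof.
pose J : 'rV[int]_n := const_mx 1.
have indegE w : (J *m kautz_mx) 0 w = (indegree (kautz n d) w)%:Z.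
  rewrite mxE /indegree -natz natr_sum; apply: eq_bigr => u _.
  by rewrite !mxE mul1r natz.
have JAE : J *m kautz_mx *m shift_mx = 0.
  by rewrite -mulmxA kautz_shift mulmxN mulmxA mul_shift_const mul0mx oppr0.
have Jc := mul_shift_eq0 JAE.
have := coord_sum_kautz J; rewrite Jc !coord_sumE /functional.
under eq_bigr do rewrite mxE; under [in RHS]eq_bigr do rewrite mxE.
rewrite !sumr_const card_ord !mulr1 mulr_natr.
move/eqP; rewrite eqrMn2r eqn0Ngt n_gt0 /= => /eqP J0.
by apply/eqP; rewrite -eqz_nat -indegE Jc mxE J0 natz.
Qed.

Lemma laplacian_kautz : laplacian (kautz n d) = d%:R%:M - kautz_mx.
Proof.
apply/matrixP => v w; rewrite !mxE indegree_kautz.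
by case: eqP => _; rewrite ?mulr1n ?mulr0n ?natz.
Qed.

Lemma laplacian_kautz_shift :
  laplacian (kautz n d) *m shift_mx = shift_mx *m (d%:R%:M + mulNd_mx).
Proof.
rewrite laplacian_kautz mulmxBl kautz_shift opprK mulmxDr.
by rewrite mul_scalar_mx mul_mx_scalar.
Qed.

Lemma laplacian_kautz_row_sum v : \sum_w laplacian (kautz n d) v w = 0.
Proof.
have := coord_sum_kautz (delta_mx 0 v).
rewrite -rowE coord_sumE /functional.
have -> : coord_sum (delta_mx 0 v : 'rV[int]_n) = 1.
  by rewrite coord_sumE functional_delta.
under eq_bigr do rewrite mxE mulr1; rewrite mulr1 => sumE.
rewrite laplacian_kautz;
  under eq_bigr => w _ do rewrite mxE [(- kautz_mx) v w]mxE.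
rewrite sumrB sumE (bigD1 v) //= mxE eqxx big1 ?addr0 ?subrr // => w wv.
by rewrite mxE eq_sym (negPf wv).
Qed.

(** Multiplication by x - 1 is injective on vectors of sum 0. It carries the row
    lattice of the Laplacian onto (d + phi) applied to the vectors of sum 0,
    which is the lattice of relations cut down to sum 0, and its image modulo
    e_0 consists of the vectors of weight divisible by n. *)
Lemma kautz_decomposition (T : finType) (B : pred T) (f : T -> 'rV[int]_n)
    (r : T -> nat) :
  decomposes (fun x => (n %| weight x)%Z) kautz_relation B f r ->
  exists f', decomposes (fun x => coord_sum x = 0)
    (in_row_lattice (laplacian (kautz n d))) B f' r.
Proof.
apply: (decomposition_preimage (E := mulmxr shift_mx)) => /=.
- exact: subgroup_kautz_relation.
- exact: subgroup_coord_sum.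
- by move=> z z0; have := weight_shift z; rewrite z0 subr0.
- move=> x nx; have [c cE] := mul_shift_onto x.
  have rel0 b : kautz_relation (b *: point 0).
    rewrite -[b]intz scaler_int.
    exact/(subgroupMz subgroup_kautz_relation)/kautz_relation_point0.
  have /dvdzP[b bE] : (n %| coord_sum c)%Z.
    have xE : x = coord_sum x *: point 0 + c *m shift_mx.
      by rewrite -cE addrC subrK.
    move: nx; rewrite xE raddfD /= rpredDl.
      by move=> nc; have := rpredB nc (weight_shift c); rewrite subKr.
    exact/kautz_relation_weight/rel0.
  exists (c - const_mx b).
    rewrite raddfB /= bE coord_sumE /functional.
    under eq_bigr do rewrite mxE mulr1.
    by rewrite sumr_const card_ord -mulr_natr natz subrr.
  by rewrite mulmxBl mul_shift_const subr0 -cE opprB addrC subrK.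
move=> z z0; split=> [[c ->]|[h [b zE]]].
  exists (c *m shift_mx), 0.
  by rewrite scale0r addr0 -!mulmxA laplacian_kautz_shift.
have pt0 : point 0 *m (d%:R%:M + mulNd_mx) = (d.+1)%:R *: point 0.
  by rewrite mulmxDr mul_mx_scalar point_mul mulr0 -[X in _ + X]scale1r
    -scalerDl -natr1.
have [c cE] := mul_shift_onto h.
(* Multiplication by x - 1 yields sum 0, and d + phi multiplies sums by d + 1. *)
have bE : b = - (coord_sum h * d.+1%:R).
  have := coord_sum_shift z; rewrite zE raddfD /= coord_sum_mul.
  rewrite !coord_sumE functionalZ functional_point mulr1 mulrC => /eqP.
  by rewrite addrC addr_eq0 => /eqP.
(* The difference is then constant, with sum 0. *)
have /mul_shift_eq0 zc : (z - c *m laplacian (kautz n d)) *m shift_mx = 0.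
  rewrite mulmxBl -mulmxA laplacian_kautz_shift mulmxA -cE zE bE mulmxBl.
  by rewrite -scalemxAl pt0 scalerA scaleNr subrr.
have : coord_sum (z - c *m laplacian (kautz n d)) = 0.
  rewrite raddfB /= z0 sub0r coord_sumE /functional.
  under eq_bigr do rewrite mxE mulr1.
  rewrite exchange_big big1 ?oppr0 // => v _.
  by rewrite -mulr_sumr laplacian_kautz_row_sum mulr0.
rewrite zc coord_sumE /functional; under eq_bigr do rewrite mxE mulr1.
rewrite sumr_const card_ord => /eqP;
  rewrite mulrn_eq0 eqn0Ngt n_gt0 /= => /eqP z00.
exists c; apply/eqP; rewrite -subr_eq0 zc z00.
by apply/eqP/rowP => w; rewrite !mxE.
Qed.

End KautzRelations.

(** * Images of the iterates of multiplication by -d *)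

Section KautzNumbers.
Variables (n d : nat) (n_gt0 : 0 < n).

(** The recursion defining n_i solves to n_i = n / gcd(n, d^i), since n_i is
    prime to d^i / gcd(n, d^i). *)
Lemma kautz_n_gcd i : kautz_n n d i * gcdn n (d ^ i) = n.
Proof.
elim: i => [|i IH] /=; first by rewrite expn0 gcdn1 muln1.
set ni := kautz_n n d i in IH *; set q := gcdn n (d ^ i) in IH *.
have q_gt0 : 0 < q by rewrite gcdn_gt0 n_gt0.
have /dvdnP[e dE] : q %| d ^ i by apply: dvdn_gcdr.
have ce : coprime ni e.
  rewrite /coprime -(eqn_pmul2r q_gt0) mul1n muln_gcdl -dE IH; exact/eqP.
have -> : gcdn n (d ^ i.+1) = gcdn ni d * q.
  by rewrite expnSr dE -{1}IH -mulnA [q * d]mulnC mulnA -muln_gcdl Gauss_gcdr.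
by rewrite mulnA divnK ?dvdn_gcdl.
Qed.

Lemma kautz_n_gt0 i : 0 < kautz_n n d i.
Proof. by have := n_gt0; rewrite -{1}(kautz_n_gcd i) muln_gt0 => /andP[]. Qed.

Lemma kautz_nS i : kautz_n n d i.+1 * kautz_g n d i = kautz_n n d i.
Proof. by rewrite /= divnK ?dvdn_gcdl. Qed.

Lemma gcd_expS i : gcdn n (d ^ i.+1) = gcdn n (d ^ i) * kautz_g n d i.
Proof.
apply/eqP; rewrite -(eqn_pmul2l (kautz_n_gt0 i.+1)) kautz_n_gcd mulnCA mulnC.
by rewrite kautz_nS kautz_n_gcd.
Qed.

Lemma kautz_g_gt0 i : 0 < kautz_g n d i.
Proof. by rewrite gcdn_gt0 kautz_n_gt0. Qed.

Lemma kautz_n_dvd i j : i <= j -> kautz_n n d j %| kautz_n n d i.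
Proof.
move=> /subnK <-; elim: (j - i) => // l IH; rewrite addSn.
by apply: dvdn_trans IH; rewrite -(kautz_nS (l + i)) dvdn_mulr.
Qed.

Lemma gcd_exp_dvd i j : i <= j -> gcdn n (d ^ i) %| gcdn n (d ^ j).
Proof. by move=> ij; rewrite dvdn_gcd dvdn_gcdl (dvdn_trans (dvdn_gcdr _ _))
  ?dvdn_exp2l. Qed.

Lemma card_multiples q : q %| n -> #|[set x : 'I_n | q %| x]| = n %/ q.
Proof.
move=> qn; have q0 : 0 < q by case: (q) qn n_gt0 => // /[!dvd0n]/eqP->.
pose h (i : 'I_(n %/ q)) : 'I_n := insubd (Ordinal n_gt0) (i * q).
have hE i : h i = i * q :> nat.
  by rewrite val_insubd; have -> : i * q < n by rewrite -ltn_divRL.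
rewrite -[RHS]card_ord -[RHS](card_imset (f := h)); last first.
  move=> i j /(congr1 val); rewrite /= !hE => /eqP; rewrite eqn_pmul2r //.
  by move/eqP/val_inj.
apply: eq_card => x; rewrite !inE; apply/idP/imsetP => [/dvdnP[y xE]|[i _ ->]].
  have lt_y : y < n %/ q by rewrite ltn_divRL // -xE.
  by exists (Ordinal lt_y) => //; apply/val_inj; rewrite /= hE.
by rewrite hE dvdn_mull.
Qed.

End KautzNumbers.

Section Levels.
Local Open Scope ring_scope.
Variables (n d : nat) (n_gt0 : (0 < n)%N).
Local Notation residue := (int_residue n_gt0).
Local Notation tau := (@mulNd d n).
Local Notation q i := (gcdn n (d ^ i)).

(** Membership in the image of tau^i, which is the subgroup of Z_n generated by
    gcd(n, d^i) and has n_i elements. *)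
Definition level (i : nat) (x : 'I_n) : bool := (gcdn n (d ^ i) %| x)%N.

Lemma level_residue i z : level i (residue z) = (q i %| z)%Z.
Proof.
have -> : level i (residue z) = (q i %| (residue z)%:Z)%Z by [].
rewrite val_residue [in RHS](divz_eq z n) [RHS]rpredDl //.
by apply: dvdz_mull; rewrite dvdzE dvdn_gcdl.
Qed.

Lemma level0 x : level 0 x.
Proof. by rewrite /level expn0 gcdn1 dvd1n. Qed.

Lemma levelW i j x : (i <= j)%N -> level j x -> level i x.
Proof. by move/(gcd_exp_dvd n d)/dvdn_trans; apply. Qed.

Lemma level_residue0 i : level i (residue 0).
Proof. by rewrite level_residue dvdz0. Qed.

Lemma iter_tau j z : iter j tau (residue z) = residue ((- d%:Z) ^+ j * z).
Proof.
elim: j => [|j IH] /=; first by rewrite expr0 mul1r.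
by rewrite IH mulNd_residue exprS mulrA.
Qed.

Lemma level_tau i x : level i x -> level i.+1 (tau x).
Proof.
move=> xi; rewrite -[x](residue_ord n_gt0) mulNd_residue level_residue.
rewrite gcd_expS // mulNr rpredN mulrC PoszM; apply: dvdz_mul.
  exact: xi.
by rewrite dvdzE dvdn_gcdr.
Qed.

Lemma level_tau_iter i j x : level i x -> level (j + i) (iter j tau x).
Proof. by move=> xi; elim: j => //= j IH; rewrite addSn; apply: level_tau. Qed.

Lemma level_tauP i w : level i.+1 w -> exists2 z, level i z & tau z = w.
Proof.
rewrite {1}/level gcd_expS // => /dvdnP[w' wE].
have [u [v uv]] := Bezoutz (kautz_n n d i) d.
have {}uv : u * (kautz_n n d i)%:Z + v * d%:Z = (kautz_g n d i)%:Z by rewrite uv.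
(* Bezout for n_i and d divides by -d modulo n_i. *)
exists (residue ((q i)%:Z * (- v * w'%:Z))).
  by rewrite -/(level i _) level_residue dvdz_mulr.
rewrite mulNd_residue -[w](residue_ord n_gt0) wE; apply/eqP.
rewrite residue_eq eqz_mod_dvd.
have nE : n%:Z = (kautz_n n d i)%:Z * (q i)%:Z by rewrite -PoszM kautz_n_gcd.
rewrite !PoszM -uv; apply/dvdzP; exists (- u * w'%:Z); rewrite nE.
ring.
Qed.

Lemma iter_tau_inj j x y : iter j tau x = iter j tau y ->
  (kautz_n n d j %| (x : nat)%:Z - (y : nat)%:Z)%Z.
Proof.
rewrite -(residue_ord n_gt0 x) -(residue_ord n_gt0 y) !iter_tau !residue_ord.
move/eqP; rewrite residue_eq eqz_mod_dvd -mulrBr.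
rewrite exprNn -mulrA mulrC dvdzE abszM abszX abszN1 exp1n muln1 abszM abszX.
set z := _ - _ => nz.
have /dvdnP[e dE] : (q j %| d ^ j)%N by apply: dvdn_gcdr.
have q0 : (0 < q j)%N by rewrite gcdn_gt0 n_gt0.
have ce : coprime (kautz_n n d j) e.
  by rewrite /coprime -(eqn_pmul2r q0) mul1n muln_gcdl -dE kautz_n_gcd.
move: nz; rewrite !absz_nat -[X in (X %| _)%N](kautz_n_gcd d n_gt0 j) /= [X in
  (_ %| X * _)%N]dE mulnAC dvdn_pmul2r //.
by rewrite Gauss_dvdr // dvdzE.
Qed.

Section Stable.
Variable k : nat.
Hypothesis g_k : kautz_g n d k = 1%N.

Lemma level_stable x : level k.+1 x = level k x.
Proof. by rewrite /level gcd_expS // g_k muln1. Qed.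

Lemma tau_inj_stable x y : level k x -> level k y -> tau x = tau y -> x = y.
Proof.
move=> xk yk xy.
have := @iter_tau_inj k.+1 x y; rewrite !iterSr xy => /(_ erefl) nxy.
have qxy : (q k %| (x : nat)%:Z - (y : nat)%:Z)%Z by apply: rpredB.
rewrite -[x](residue_ord n_gt0) -[y](residue_ord n_gt0); apply/eqP.
rewrite residue_eq eqz_mod_dvd -[X in (Posz X %| _)%Z](kautz_n_gcd d n_gt0 k)
  PoszM Gauss_dvdz.
  by rewrite qxy -(kautz_nS n d k) g_k muln1 nxy.
rewrite /coprimez /gcdz /= eqz_nat; apply: (coprime_dvdr (dvdn_gcdr n _)).
by rewrite coprimeXr // /coprime -[gcdn _ _]/(kautz_g n d k) g_k.
Qed.

(** A section of tau choosing preimages as deep as possible. On the stable image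
    it is forced to be the inverse of tau. *)
Definition deep_section (s : 'I_n -> 'I_n) : Prop :=
  forall w j, (j <= k)%N -> level j.+1 w -> tau (s w) = w /\ level j (s w).

Lemma deep_section_exists : exists s, deep_section s.
Proof.
suff H (w : 'I_n) : exists z, forall j, (j <= k)%N -> level j.+1 w -> tau z = w
  /\ level j z.
  by have [s sP] := choice H; exists s.
elim: k => [|k' [z IH]].
  have [/level_tauP[z _ zw]|w1] := boolP (level 1 w).
    by exists z => j; rewrite leqn0 => /eqP-> _; split=> //; apply: level0.
  by exists w => j; rewrite leqn0 => /eqP->; rewrite (negPf w1).
have [/level_tauP[z' z'k zw]|wk] := boolP (level k'.+2 w).
  by exists z' => j jk _; split=> //; apply: levelW z'k.
exists z => j; rewrite leq_eqVlt ltnS => /orP[/eqP->|]; last exact: IH.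
by rewrite (negPf wk).
Qed.

Variable s : 'I_n -> 'I_n.
Hypothesis sP : deep_section s.

Lemma tau_section w : level 1 w -> tau (s w) = w.
Proof. by move=> w1; have [] := @sP w 0 isT w1. Qed.

Lemma level_section j w : (j <= k)%N -> level j.+1 w -> level j (s w).
Proof. by move=> jk wj; have [] := sP jk wj. Qed.

Lemma iter_section j l w : (j + l <= k.+1)%N -> level (j + l) w ->
  level l (iter j s w) /\ iter j tau (iter j s w) = w.
Proof.
elim: j l => [|j IH] l //= jl wjl.
have [||h1 h2] := IH l.+1; rewrite ?addnS //.
split; first by apply: level_section => //;
  rewrite -ltnS (leq_trans _ jl) // ltnS leq_addl.
by rewrite -iterS iterSr tau_section //; apply: levelW h1.
Qed.

Lemma iter_tau_section i j w : (i <= j)%N -> (j <= k.+1)%N -> level j w ->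
  iter i tau (iter j s w) = iter (j - i) s w.
Proof.
move=> ij jk wj; rewrite -{1}(subnKC ij) iterD.
apply: (iter_section (l := 0) _ _).2.
  by rewrite addn0 (leq_trans ij).
rewrite addn0; apply: (iter_section (j := j - i) _ _).1; rewrite subnK //.
Qed.

Lemma section_stable w : level k w -> level k (s w).
Proof. by rewrite -level_stable; apply: level_section. Qed.

Lemma section_tau_stable x : level k x -> s (tau x) = x.
Proof.
move=> xk; have tk := level_tau xk.
apply: tau_inj_stable => //; first exact: level_section.
by apply: tau_section; apply: levelW tk.
Qed.

(** The starting points of the chains y, s y, ..., s^i y outside the cycles: y is
    not the preferred preimage of its image. *)
Definition chain_top (i : nat) (y : 'I_n) : bool :=
  [&& level i y, ~~ level i.+1 y & s (tau y) != y].

Lemma topP i y : chain_top i y -> [/\ level i y, ~~ level i.+1 y & s (tau y) !=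
  y].
Proof. by case/and3P. Qed.

Lemma level_uniq i j y : level i y -> ~~ level i.+1 y -> level j y ->
  ~~ level j.+1 y -> i = j.
Proof.
move=> yi yi1 yj yj1; case: (ltngtP i j) => // ij.
  by case/negP: yi1; apply: levelW ij yj.
by case/negP: yj1; apply: levelW ij yi.
Qed.

(** The other elements of level exactly i are in bijection, under tau and s, with
    the elements of level exactly i + 1. *)
Lemma card_top i : (i < k)%N ->
  #|[set y | chain_top i y]| =
    (kautz_n n d i + kautz_n n d i.+2 - 2 * kautz_n n d i.+1)%N.
Proof.
move=> ik.
have cardE j : #|[set y : 'I_n | level j y]| = kautz_n n d j.
  rewrite card_multiples ?dvdn_gcdl // -[X in (X %/ _)%N](kautz_n_gcd d n_gt0
    j) mulnK //.
  by rewrite gcdn_gt0 n_gt0.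
have cardD j : #|[set y | level j y && ~~ level j.+1 y]| =
    (kautz_n n d j - kautz_n n d j.+1)%N.
  rewrite -!cardE -cardsDS; last by apply/subsetP => y; rewrite !inE;
    apply: levelW.
  by apply: eq_card => y; rewrite !inE andbC.
have -> : [set y | chain_top i y] = [set y | level i y && ~~ level i.+1 y] :\:
    s @: [set y | level i.+1 y && ~~ level i.+2 y].
  apply/setP => y; rewrite !inE /chain_top andbA [RHS]andbC.
  have [/andP[yi yi1] /=|] //= := boolP (level i y && ~~ level i.+1 y).
  congr negb; apply/eqP/imsetP => [yE|[w]].
    exists (tau y) => //; rewrite inE level_tau //=.
    by apply: contra yi1 => yi2; rewrite -yE; apply: level_section yi2.
  by rewrite inE => /andP[w1 _] ->; rewrite tau_section //; apply: levelW w1.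
rewrite cardsDS; last first.
  apply/subsetP => y /imsetP[w]; rewrite !inE => /andP[w1 w2] ->.
  rewrite level_section ?(ltnW ik) //=; apply: contra w2 => /level_tau.
  by rewrite tau_section //; apply: levelW w1.
rewrite card_in_imset; last first.
  move=> w w'; rewrite !inE => /andP[w1 _] /andP[w1' _] /(congr1 tau).
  by rewrite !tau_section ?(levelW _ w1) ?(levelW _ w1').
rewrite !cardD.
have := dvdn_leq (kautz_n_gt0 d n_gt0 i) (kautz_n_dvd n d (leqnSn i)).
have := dvdn_leq (kautz_n_gt0 d n_gt0 i.+1) (kautz_n_dvd n d (leqnSn i.+1)).
move: (kautz_n n d i) (kautz_n n d i.+1) (kautz_n n d i.+2) => a b c.
by clear; lia.
Qed.

End Stable.
End Levels.

Local Open Scope ring_scope.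

(** * Decomposition of the group generated by the vertices *)

(** Functionals dual to the generators, with values modulo their orders, detect
    all relations. *)
Lemma decomposition_by_functionals (A : zmodType) (L : A -> Prop) (T : finType)
    (B : pred T) (f : T -> A) (r : T -> nat) (c : T -> {additive A -> int}) :
  subgroup L ->
  (forall x, exists a : T -> int, L (x - \sum_(t | B t) f t *~ a t)) ->
  (forall t, B t -> L (f t *+ r t)) ->
  (forall t x, B t -> L x -> (r t %| c t x)%Z) ->
  (forall t u, B t -> B u -> c t (f u) = (t == u)%:R) ->
  decomposes (fun=> True) L B f r.
Proof.
move=> sgL gen rf cL cf; split=> // a; split=> [La t Bt|ra].
  have := cL t _ Bt La; rewrite raddf_sum (bigD1 t) //= raddfMz cf // eqxx.
  rewrite -mulrzl mulr1 intz big1 ?addr0 // => u /andP[Bu /negPf ut].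
  by rewrite raddfMz cf // eq_sym ut mul0rz.
apply: subgroup_sum => // t Bt; have /dvdzP[z ->] := ra t Bt.
by rewrite mulrC mulrzA -pmulrn; apply: subgroupMz => //; apply: rf.
Qed.

Lemma mulNd_inj d m : (0 < m)%N -> coprime m d -> injective (@mulNd d m).
Proof.
move=> m0 cmd x y; rewrite !(mulNdE m0) => /eqP.
rewrite residue_eq eqz_mod_dvd -mulrBr mulNr rpredN Gauss_dvdzr //.
rewrite -eqz_mod_dvd => /eqP /(residueP m0).
by rewrite !residue_ord.
Qed.

Section InitialDecomposition.
Variables (n d k : nat) (n_gt0 : (0 < n)%N).
Hypothesis g_k : kautz_g n d k = 1%N.
Variable s : 'I_n -> 'I_n.
Hypothesis sP : deep_section d k s.
Local Notation m := (kautz_n n d k).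
Variable V : {set 'I_m}.
Hypothesis V_reps : orbit_representatives d V.

Local Notation residue := (int_residue n_gt0).
Local Notation point := (residue_vector n_gt0).
Local Notation rel := (kautz_relation d n_gt0).
Local Notation tau := (@mulNd d n).
Local Notation tau_m := (@mulNd d m).
Local Notation q := (gcdn n (d ^ k)).

(** Pairs (i, y) index the summands of d-power order, elements of 'I_m those of
    the cycles. *)
Definition kautz_index := ('I_k * 'I_n + 'I_m)%type.

Definition kautz_support (t : kautz_index) : bool :=
  match t with inl (i, y) => chain_top d s i y | inr v => v \in V end.

(** Multiplication by n / m identifies Z_m with the stable image of tau. Both
    vertices of a generator at (i, y) have the same image under tau^(i+1), which
    is why d^(i+1) kills it. *)
Definition kautz_generator (t : kautz_index) : 'rV[int]_n :=
  match t with
  | inl (i, y) => point (iter i s y) - point (iter i.+1 s (tau y))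
  | inr v => point (q * v)%N
  end.

Definition kautz_exponent (t : kautz_index) : nat :=
  match t with
  | inl (i, y) => d ^ i.+1
  | inr v => `|((- d%:Z) ^+ fingraph.order tau_m v - 1)%R|
  end%N.

Let sgrel : subgroup rel := subgroup_kautz_relation d n_gt0.
Let m_gt0 : (0 < m)%N := kautz_n_gt0 d n_gt0 k.

Lemma kautz_coprime : coprime m d.
Proof. by rewrite /coprime -[gcdn _ _]/(kautz_g n d k) g_k. Qed.

Lemma coprime_gcd_exp : coprime m q.
Proof. by apply: (coprime_dvdr (dvdn_gcdr n _));
  rewrite coprimeXr // kautz_coprime. Qed.

Let tau_m_inj : injective tau_m := mulNd_inj m_gt0 kautz_coprime.

Let nE : n%:Z = m%:Z * q%:Z.
Proof. by rewrite -PoszM kautz_n_gcd. Qed.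

Lemma rel_iter j (x : 'I_n) :
  rel (point (iter j tau x) - (- d%:Z) ^+ j *: point x).
Proof.
elim: j => [|j IH] /=; first by rewrite expr0 scale1r subrr; apply: subgroup0.
set z := iter j tau x in IH *.
have alg (P Y X : 'rV[int]_n) (D e : int) :
    P - (- D * e) *: X = P + D *: Y - (Y - e *: X) *~ D.
  rewrite -scaler_int intz scalerBr scalerA mulNr scaleNr opprK opprB.
  by rewrite addrACA subrr addr0.
have taus : tau z = residue (- d%:Z * (z : nat)%:Z) := mulNdE n_gt0 d z.
rewrite exprS (alg _ (point z)) /residue_vector residue_ord taus.
apply: subgroupB => //; last by apply: subgroupMz.
by have := kautz_relation_mul d n_gt0 (z : nat)%:Z;
  rewrite natz /residue_vector residue_ord.
Qed.

Lemma iter_tau_emb j (v : 'I_m) :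
  iter j tau (residue (q * v)%N) = residue (q * iter j tau_m v)%N.
Proof.
elim: j => //= j ->; rewrite mulNd_residue (mulNdE m_gt0).
apply: residueP; apply/eqP; rewrite eqz_mod_dvd !PoszM val_residue.
set w := Posz (nat_of_ord (iter j tau_m v)).
have /dvdzP[e eE] : (m %| - d%:Z * w - (- d%:Z * w %% m)%Z)%Z.
  by rewrite -eqz_mod_dvd modz_mod.
apply/dvdzP; exists e.
rewrite -/w nE; transitivity (q%:Z * (- d%:Z * w - (- d%:Z * w %% m)%Z));
  first by ring.
by rewrite eE; ring.
Qed.

Let span (x : 'rV[int]_n) : Prop :=
  exists a : kautz_index -> int,
    rel (x - \sum_(t | kautz_support t) kautz_generator t *~ a t).

Let sg_span : subgroup span.
Proof.
split=> [|x y [a xa] [b yb]].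
  exists (fun=> 0); rewrite big1 ?subrr; first exact: subgroup0.
  by move=> t _; rewrite mulr0z.
exists (fun t => a t - b t).
have -> : \sum_(t | kautz_support t) kautz_generator t *~ (a t - b t) =
    \sum_(t | kautz_support t) kautz_generator t *~ a t -
    \sum_(t | kautz_support t) kautz_generator t *~ b t.
  by rewrite -sumrB; apply: eq_bigr => t _; rewrite mulrzBr.
by rewrite opprB [X in _ + X]addrC addrACA [- y + _]addrC -[_ - y]opprB;
  apply: subgroupB.
Qed.

Let span_rel x : rel x -> span x.
Proof.
exists (fun=> 0); rewrite big1 ?subr0 // => t _; exact: mulr0z.
Qed.

Let span_gen t : kautz_support t -> span (kautz_generator t).
Proof.
move=> Bt; exists (fun u => if u == t then 1 else 0).
rewrite (bigD1 t) //= eqxx mulr1z big1 ?addr0 ?subrr; first exact: subgroup0.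
by move=> u /andP[_ /negPf->]; rewrite mulr0z.
Qed.

Let span_iter j (x : 'I_n) : span (point x) -> span (point (iter j tau x)).
Proof.
move=> xs; rewrite -[point (iter j tau x)](subrK ((- d%:Z) ^+ j *: point x)).
apply: subgroupD => //; first exact/span_rel/rel_iter.
by rewrite -[_ ^+ j]intz scaler_int; apply: subgroupMz.
Qed.

Lemma orbit_rep (v : 'I_m) : (v : nat) <> 0%N ->
  exists2 w, w \in V & exists j, v = iter j tau_m w.
Proof.
move=> v0; have [_ /(_ v v0)[w [[wV wv] _]]] := V_reps.
exists w => //; move: wv; rewrite -fconnect_orbit fconnect_sym //.
by case/iter_findex => <-; exists (findex tau_m w v).
Qed.

Let span_stable (x : 'I_n) : level d k x -> span (point x).
Proof.
move=> /dvdnP[y xE]; have ym : (y < m)%N.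
  have q0 : (0 < q)%N by rewrite gcdn_gt0 n_gt0.
  by rewrite -(ltn_pmul2r q0) -xE kautz_n_gcd.
have {}xE : (x : nat) = (q * Ordinal ym)%N by rewrite xE mulnC.
have [y0|y0] := posnP y.
  by rewrite xE /= y0 muln0; apply/span_rel/kautz_relation_point0.
have [|w wV [j wE]] := @orbit_rep (Ordinal ym); first by rewrite /=; lia.
have -> : x = iter j tau (residue (q * w)%N).
  by rewrite iter_tau_emb -wE -xE residue_ord.
apply: span_iter; rewrite {1}/residue_vector residue_ord.
exact: (span_gen (t := inr w)).
Qed.

(** If the first failure of s (tau z) = z along x, tau x, tau^2 x, ... occurs at
    y = tau^J x, then y is a chain top of some level i >= J and e_x is a multiple
    of e_(s^i y). The generator at (i, y) trades this vertex for
    s^(i+1) (tau y), for which the first failure occurs later. The induction is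
    on how far from k the first failure can occur; without failure before k the
    vertex is on a cycle. *)
Let span_point (x : 'I_n) : span (point x).
Proof.
suff H e : forall x : 'I_n,
    (forall j, (j < k - e)%N -> s (tau (iter j tau x)) = iter j tau x) ->
    span (point x).
  by apply: (H k) => j; rewrite subnn.
elim: e => [|e IH] {}x good.
  have xE j : (j <= k)%N -> iter j s (iter j tau x) = x.
    elim: j => // j IHj jk; rewrite iterSr /= good ?subn0 //.
    by apply: IHj; apply: ltnW.
  apply: span_stable; rewrite -(xE k) //.
  have : level d k (iter k tau x) by rewrite -[X in level _ X]addn0;
    apply/level_tau_iter/level0.
  have stable j w : level d k w -> level d k (iter j s w).
    by elim: j => //= j IHj wk; apply: (section_stable n_gt0 g_k sP); apply: IHj.
  exact: stable.
have [ke|ek] := leqP k e.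
  by apply: IH => j; rewrite (eqP ke).
pose J := (k - e.+1)%N; set y := iter J tau x.
have [yE|ytop] := eqVneq (s (tau y)) y.
  apply: IH => j; case: (ltnP j J) => [jJ _|Jj jk]; first exact: good.
  by have -> : j = J by rewrite /J in Jj *; lia.
have yJ : level d J y by rewrite -[J in level _ J]addn0;
  apply/level_tau_iter/level0.
have yk : ~~ level d k y.
  by apply/negP => yk; case/eqP: ytop; apply: (section_tau_stable n_gt0 g_k sP).
have [i iP imin] : exists2 i, ~~ level d i.+1 y & forall j, (j < i)%N -> level
  d j.+1 y.
  have exP : exists i, ~~ level d i.+1 y.
    by exists k; rewrite level_stable.
  exists (ex_minn exP); case: ex_minnP => // i _ imin j ji.
  by apply/negPn/negP => /imin; rewrite leqNgt ji.
have yi : level d i y by case: (i) imin => [_|j]; [apply: level0 | apply].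
have Ji : (J <= i)%N by rewrite leqNgt; apply: contra iP => /levelW; apply.
have ik : (i < k)%N by rewrite ltnNge; apply: contra yk => /levelW; apply.
have xE : iter J s y = x.
  have H j : (j <= J)%N -> iter j s (iter j tau x) = x.
    elim: j => // j IHj jk; rewrite iterSr /= good; last by rewrite /J in jk *;
      lia.
    by apply: IHj; apply: ltnW.
  exact: H.
have xE' : iter (i - J) tau (iter i s y) = x.
  rewrite (iter_tau_section sP) ?leq_subr ?(ltnW (leq_trans ik _)) //.
  by rewrite subKn.
have top_y : chain_top d s i y by rewrite /chain_top yi iP ytop.
rewrite -xE'; apply: span_iter.
rewrite -[X in span X](subrK (point (iter i.+1 s (tau y)))).
apply: subgroupD => //; first exact: (span_gen (t := inl (Ordinal ik, y))).
have ty : level d i.+1 (tau y) by apply: level_tau.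
apply: IH => j jk.
have ji : (j <= i)%N by rewrite /J in Ji; lia.
rewrite (iter_tau_section sP) ?ltnS ?(ltnW ik) ?(leqW ji) //.
rewrite subSn //= (tau_section sP) //.
have [||] := @iter_section _ _ _ s sP (i - j) j.+1 (tau y).
- by rewrite addnS subnK // ltnS ltnW.
- by rewrite addnS subnK.
by move=> h _; apply: levelW h.
Qed.

Let span_all x : span x.
Proof.
rewrite (row_sum_point n_gt0 x); apply: subgroup_sum => // v _.
by rewrite -[x 0 v]intz scaler_int; apply: subgroupMz.
Qed.

Lemma rel_same_image j (x x' : 'I_n) : iter j tau x = iter j tau x' ->
  rel ((point x - point x') *+ d ^ j).
Proof.
move=> xx'; have := subgroupB sgrel (rel_iter j x') (rel_iter j x).
rewrite xx' opprB addrC subrKA -scalerBr exprNn -signr_odd -[d%:Z]natz -natrX.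
rewrite -scalerA scaler_nat.
case: (odd j); rewrite ?scale1r // scaleN1r => /(subgroupN sgrel).
by rewrite opprK.
Qed.

Let generator_exponentP t : kautz_support t ->
  rel (kautz_generator t *+ kautz_exponent t).
Proof.
case: t => [[i y]|v] Bt.
  have [yi yi1 ytop] := topP Bt; have ik := ltn_ord i.
  have ty : level d i.+1 (tau y) by apply: level_tau.
  apply: rel_same_image.
  rewrite iterS (iter_tau_section sP) ?subnn ?(iter_tau_section sP) ?subnn //;
    lia.
have := rel_iter (fingraph.order tau_m v) (residue (q * v)%N).
rewrite iter_tau_emb iter_order // => relv.
rewrite /kautz_exponent /kautz_generator.
set D := (- d%:Z) ^+ _ in relv *.
have {}relv : rel (point (q * v)%N *~ (D - 1)).
  rewrite mulrzBr mulr1z -scaler_int intz -opprB; apply: subgroupN => //.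
  by move: relv; rewrite {1 2}/residue_vector residue_ord.
case: (D - 1) relv => // j.
by rewrite NegzE mulrNz abszN => /(subgroupN sgrel); rewrite opprK.
Qed.

(** A vertex x with tau^j x = y takes the value (-d)^(i-j), and a vertex that never
    reaches y the value 0. This respects e_(tau x) = - d e_x, and at x = y it does
    so modulo d^(i+1). *)
Definition top_functional (i : nat) (y : 'I_n) (x : 'I_n) : int :=
  \sum_(j < i.+1) (iter j tau x == y)%:R * (- d%:Z) ^+ (i - j).

Lemma top_functional_rel i y x : chain_top d s i y ->
  rel x -> ((d ^ i.+1)%N %| functional (top_functional i y) x)%Z.
Proof.
move=> Bt; have [yi yi1 ytop] := topP Bt.
have never j x' : (i < j)%N -> iter j tau x' == y = false.
  move=> ij; apply: contraNF yi1 => /eqP <-; apply: levelW ij _.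
  by rewrite -[X in level _ X]addn0; apply/level_tau_iter/level0.
apply: functional_kautz_relation => [|v].
  rewrite /top_functional big1 ?dvdz0 // => j _.
  rewrite iter_tau mulr0; case: eqP => [y0|_]; last by rewrite mul0r.
  by case/negP: yi1; rewrite -y0 level_residue0.
(* Shifting the index by one, all terms cancel except the one with j = 0. *)
rewrite /top_functional big_ord_recr [X in d%:R * X]big_ord_recl /=.
rewrite -iterSr never // mul0r addr0 mulrDr addrCA mulr_sumr -big_split /=.
rewrite big1 ?addr0 => [|j _]; last first.
  have -> : (i - j)%N = (i - bump 0 j).+1 by rewrite /bump; have := ltn_ord j;
    lia.
  by rewrite add0n -iterS iterSr exprS natz; ring.
rewrite subn0 mulrCA; apply: dvdz_mull; rewrite exprNn mulrCA; apply: dvdz_mull.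
by rewrite -[d%:Z]natz -exprS -natrX natz.
Qed.

Lemma top_functional_generator i y t : chain_top d s i y -> kautz_support t ->
  forall ik : (i < k)%N,
  functional (top_functional i y) (kautz_generator t) =
  (inl (Ordinal ik, y) == t)%:R.
Proof.
move=> Bt Bu ik; have [yi yi1 ytop] := topP Bt.
have never x' : level d i.+1 x' -> top_functional i y x' = 0.
  move=> xi; apply: big1 => j _; case: eqP => [xy|_]; last by rewrite mul0r.
  case/negP: yi1; rewrite -xy; apply: levelW (level_tau_iter n_gt0 j xi).
  exact: leq_addl.
case: t Bu => [[i' y']|v] /= Bu; last first.
  rewrite functional_point never // level_residue.
  apply: (dvdz_trans (n := q)); first exact: gcd_exp_dvd.
  by rewrite PoszM dvdz_mulr.
have [yi' yi1' ytop'] := topP Bu; have ik' := ltn_ord i'.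
have ty' : level d i'.+1 (tau y') by apply: level_tau.
rewrite raddfB /= !functional_point !residue_ord -sumrB.
rewrite -[s (iter i' s _)]/(iter i'.+1 s (tau y')).
have good u : level d 1 u -> s u == y = false.
  by move=> u1; apply: contraNF ytop => /eqP <-; rewrite (tau_section sP).
have goodi j l u : (j < l)%N -> (l <= k.+1)%N -> level d l u ->
    iter j tau (iter l s u) == y = false.
  move=> jl lk ul; rewrite (iter_tau_section sP) ?(ltnW jl) //.
  have lE : (l - j)%N = (l - j.+1).+1 by lia.
  rewrite lE /=; apply: good.
  have [||h _] := @iter_section _ _ _ s sP (l - j.+1) j.+1 u.
  - by rewrite subnK.
  - by rewrite subnK.
  - exact: levelW h.
have same j : (i' < j)%N ->
    iter j tau (iter i' s y') = iter j tau (iter i'.+1 s (tau y')).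
  move=> ij; rewrite -(subnK ij) !iterD iterS; congr iter.
  by rewrite !(iter_tau_section sP) ?subnn //; lia.
have self : iter i' tau (iter i' s y') = y'.
  by rewrite (iter_tau_section sP) ?subnn //; lia.
have term (j : 'I_i.+1) :
    (iter j tau (iter i' s y') == y)%:R * (- d%:Z) ^+ (i - j) -
    (iter j tau (iter i'.+1 s (tau y')) == y)%:R * (- d%:Z) ^+ (i - j) =
    if (j == i' :> nat) && (y == y') then (- d%:Z) ^+ (i - j) else 0.
  have [ji|ij|->] := ltngtP j i'.
  - by rewrite !goodi ?subrr //; lia.
  - by rewrite same // subrr.
  rewrite self goodi //= ?mul0r ?subr0; last by lia.
  by rewrite eq_sym; case: eqP; rewrite ?mul1r ?mul0r.
under eq_bigr do rewrite term.
have [yy'|yy'] := eqVneq y y'; last first.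
  rewrite big1 => [|j _]; last by rewrite andbF.
  by case: eqP => // -[] _ /eqP; rewrite (negPf yy').
have ii' : i = i' by apply: (level_uniq yi yi1); rewrite yy'.
have -> : (inl (Ordinal ik, y) == inl (i', y') :> kautz_index) = true.
  by rewrite -yy' (_ : Ordinal ik = i') ?eqxx //; apply/val_inj.
rewrite (bigD1 ord_max) //= -ii' eqxx subnn expr0 big1 ?addr0 // => j.
by rewrite -val_eqE /= => /negPf->.
Qed.

(** With u inverse to n / m modulo m, the map x |-> u x from Z_n to Z_m commutes
    with tau and inverts v |-> (n / m) v. The functional takes the value (-d)^j
    on the vertices sent to the j-th point of the orbit of v. *)
Definition orbit_functional (u : int) (v : 'I_m) (x : 'I_n) : int :=
  \sum_(j < fingraph.order tau_m v)
    (iter j tau_m v == int_residue m_gt0 (u * (x : nat)%:Z))%:R * (- d%:Z) ^+ j.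

Section OrbitFunctional.
Variable u : int.
Hypothesis uP : (m %| u * q%:Z - 1)%Z.
Local Notation rho x := (int_residue m_gt0 (u * x)).

Let rho_tau (x : 'I_n) : rho (tau x : nat)%:Z = tau_m (rho (x : nat)%:Z).
Proof.
rewrite mulNd_residue (mulNdE n_gt0) val_residue; apply: residueP.
apply/eqP; rewrite eqz_mod_dvd.
have /dvdzP[e eE] : (n %| (- d%:Z * (x : nat)%:Z %% n)%Z - - d%:Z * (x :
  nat)%:Z)%Z.
  by rewrite -eqz_mod_dvd modz_mod.
rewrite (mulrCA (- d%:Z)) -mulrBr eE nE; apply/dvdzP; exists (u * e * q%:Z).
by ring.
Qed.

Let rho_iter j (x : 'I_n) : rho (iter j tau x : nat)%:Z = iter j tau_m (rho (x
  : nat)%:Z).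
Proof. by elim: j => //= j IH; rewrite rho_tau IH. Qed.

Let rho_emb (w : 'I_m) : rho (residue (q * w)%N : nat)%:Z = w.
Proof.
rewrite -[RHS](residue_ord m_gt0) val_residue; apply: residueP.
apply/eqP; rewrite eqz_mod_dvd.
have /dvdzP[e eE] : (n %| ((q * w)%N %% n)%Z - (q * w)%N%:Z)%Z.
  by rewrite -eqz_mod_dvd modz_mod.
have {}eE : ((q * w)%N %% n)%Z = e * n%:Z + q%:Z * (w : nat)%:Z.
  by rewrite -PoszM -eE subrK.
have /dvdzP[e' e'E] := uP.
rewrite eE nE; apply/dvdzP; exists (u * e * q%:Z + e' * (w : nat)%:Z).
have -> : u * (e * (m%:Z * q%:Z) + q%:Z * (w : nat)%:Z) - (w : nat)%:Z =
  u * e * q%:Z * m%:Z + (u * q%:Z - 1) * (w : nat)%:Z by ring.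
by rewrite e'E; ring.
Qed.

Lemma orbit_functional_rel (v : 'I_m) x : v \in V -> rel x ->
  (kautz_exponent (inr v) %| functional (orbit_functional u v) x)%Z.
Proof.
move=> vV; rewrite dvdzE absz_nat -dvdzE.
have v0 : (v : nat) <> 0%N by have [H _] := V_reps; apply: H.
apply: functional_kautz_relation => [|x'].
  rewrite /orbit_functional big1 ?dvdz0 // => j _; case: eqP => [|_];
    last by rewrite mul0r.
  rewrite val_residue mod0z mulr0 => vj.
  have j0 : iter j tau_m (int_residue m_gt0 0) = int_residue m_gt0 0.
    by rewrite iter_tau mulr0.
  case: v0; have : iter j tau_m v = iter j tau_m (int_residue m_gt0 0) by
    rewrite vj j0.
  have iter_inj l a b : iter l tau_m a = iter l tau_m b -> a = b.
    by elim: l => //= l IH /tau_m_inj.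
  by move=> /iter_inj ->; apply/eqP; rewrite -eqz_nat val_residue mod0z.
rewrite /orbit_functional rho_tau; set o := fingraph.order tau_m v.
set w := rho _.
pose F j := (iter j tau_m v == tau_m w)%:R * (- d%:Z) ^+ j : int.
(* The two sums telescope up to the full turn of the orbit. *)
have -> : \sum_(j < o) (iter j tau_m v == tau_m w)%:R * (- d%:Z) ^+ j +
   d%:R * \sum_(j < o) (iter j tau_m v == w)%:R * (- d%:Z) ^+ j =
   \sum_(0 <= j < o) (F j - F j.+1).
  rewrite big_mkord sumrB; congr (_ + _); rewrite mulr_sumr -sumrN.
  apply: eq_bigr => j _; rewrite /F iterS (inj_eq tau_m_inj) exprS natz.
  by ring.
have -> : \sum_(0 <= j < o) (F j - F j.+1) = - (F o - F 0%N).
  by rewrite -telescope_sumr // -sumrN; apply: eq_bigr => j _; rewrite opprB.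
rewrite /F iter_order //= expr0 mulr1 -[X in _ - X]mulr1 -mulrBr rpredN.
exact: dvdz_mull.
Qed.

Lemma orbit_functional_generator v t : v \in V -> kautz_support t ->
  functional (orbit_functional u v) (kautz_generator t) = (inr v == t)%:R.
Proof.
move=> vV; case: t => [[i y]|w] Bt.
  rewrite raddfB /= !functional_point !residue_ord.
  rewrite -[s (iter i s _)]/(iter i.+1 s (tau y)).
  have [yi yi1 ytop] := topP Bt; have ik := ltn_ord i.
  have ty : level d i.+1 (tau y) by apply: level_tau.
  rewrite /orbit_functional.
  suff -> : rho (iter i s y : nat)%:Z = rho (iter i.+1 s (tau y) : nat)%:Z by
    rewrite subrr.
  have iter_inj l a b : iter l tau_m a = iter l tau_m b -> a = b.
    by elim: l => //= l IH /tau_m_inj.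
  apply: (iter_inj i.+1); rewrite -!rho_iter; congr (rho (_ : nat)%:Z).
  by rewrite iterS !(iter_tau_section sP) ?subnn //; lia.
rewrite /= functional_point /orbit_functional rho_emb.
have o_gt0 := fingraph.order_gt0 tau_m v.
rewrite (bigD1 (Ordinal o_gt0)) //= expr0 mulr1 big1 ?addr0 // => j.
rewrite -val_eqE /= => j0; case: eqP => [vw|_]; last by rewrite mul0r.
have v0 : (v : nat) <> 0%N by have [H _] := V_reps; apply: H.
have [_ /(_ v v0)[w' [_ uniq_w']]] := V_reps.
have wv : w = v.
  apply: etrans (uniq_w' v _); last by split; rewrite // -fconnect_orbit.
  apply/esym/uniq_w'; split=> //.
  by rewrite -vw -fconnect_orbit fconnect_iter.
have := findex_iter (ltn_ord j); rewrite vw wv findex0 => j0'.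
by rewrite -j0' in j0.
Qed.

End OrbitFunctional.

Lemma initial_decomposition :
  decomposes (fun=> True) rel kautz_support kautz_generator kautz_exponent.
Proof.
have [u [w uw]] := Bezoutz q m.
have uP : (m %| u * q%:Z - 1)%Z.
  have <- : gcdz q m = 1.
    by rewrite /gcdz /= gcdnC (eqP coprime_gcd_exp).
  by rewrite -uw opprD addNKr rpredN dvdz_mull.
pose c (t : kautz_index) := match t with
  | inl (i, y) => top_functional i y | inr v => orbit_functional u v end.
apply: (decomposition_by_functionals (c := fun t => functional (c t))).
- exact: sgrel.
- exact: span_all.
- exact: generator_exponentP.
- move=> [[i y]|v] x Bt relx; first exact: top_functional_rel.
  exact: orbit_functional_rel.
move=> [[[i ik] y]|v] t Bt Bu; first exact: top_functional_generator.
exact: orbit_functional_generator.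
Qed.

End InitialDecomposition.

Local Close Scope ring_scope.

Local Open Scope ring_scope.

(** * One cyclic quotient of the weight *)

(** The instance of [decomposition_step] for weights divisible by N and by c N.
    The multiplier of f_t0 in the correction of f_t is
    (weight f_t / N) * E * w, with w inverse to E * (weight f_t0 / N) modulo c.
    The free factor E, prime to c, serves two purposes: it can absorb the part of
    r_t0 prime to c, and corrections leave the weights unchanged modulo E.
    Generators that satisfy the new divisibility are not corrected at all. *)
Lemma weight_step (n d : nat) (n_gt0 : (0 < n)%N) (N c E : nat) (T : finType)
    (B : pred T) (f : T -> 'rV[int]_n) (r : T -> nat) (t0 : T) (z0 : int) :
  (0 < N)%N -> (0 < c)%N -> (c * N %| n)%N -> B t0 ->
  weight (f t0) = z0 * N%:Z -> coprimez c (E%:Z * z0) ->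
  (forall t, B t -> t != t0 -> ((c * N)%N %| weight (f t))%Z \/
    exists2 z, weight (f t) = z * N%:Z & (r t0 %| (r t)%:Z * (z * E%:Z))%Z) ->
  decomposes (fun x => (N %| weight x)%Z) (kautz_relation d n_gt0) B f r ->
  exists f', [/\ decomposes (fun x => ((c * N)%N %| weight x)%Z)
      (kautz_relation d n_gt0) B f'
      (fun t => if t == t0 then r t0 %/ c else r t)%N,
    (c %| r t0)%N,
    forall t, B t -> t != t0 -> ((c * N)%N %| weight (f t))%Z -> f' t = f t,
    weight (f' t0) = c%:Z * weight (f t0)
    & forall t, B t -> t != t0 -> (E %| weight (f' t) - weight (f t))%Z].
Proof.
move=> N0 c0 cNn Bt0 z0E cop LC dec.
have LM x : kautz_relation d n_gt0 x -> ((c * N)%N %| weight x)%Z.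
  by move=> /kautz_relation_weight; apply: dvdz_trans; rewrite dvdzE.
have [x [y xy]] := Bezoutz c (E%:Z * z0).
have {}xy : x * c%:Z + y * (E%:Z * z0) = 1.
  by rewrite xy; move/eqP: cop.
have [a aP] : {a : T -> int & forall t, B t -> t != t0 ->
    [/\ ((c * N)%N %| weight (f t) - a t * weight (f t0))%Z,
        (r t0 %| (r t)%:Z * a t)%Z,
        ((c * N)%N %| weight (f t))%Z -> a t = 0
      & (E %| a t)%Z]}.
  apply: (choice (P := fun t at_ => B t -> t != t0 ->
    [/\ ((c * N)%N %| weight (f t) - at_ * weight (f t0))%Z,
        (r t0 %| (r t)%:Z * at_)%Z,
        ((c * N)%N %| weight (f t))%Z -> at_ = 0
      & (E %| at_)%Z])) => t.
  have [/andP[Bt tt0]|nt] := boolP (B t && (t != t0)); last first.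
    by exists 0 => Bt tt0; case/negP: nt; rewrite Bt.
  have [cNt|cNt] := boolP ((c * N)%N %| weight (f t))%Z.
    by exists 0 => _ _; rewrite mul0r subr0 mulr0 !dvdz0.
  case: (LC t Bt tt0) => [|[z zE rz]]; first by rewrite (negPf cNt).
  exists (z * E%:Z * y) => _ _; split => //.
  - rewrite zE z0E (_ : _ - _ = (z * x) * (c * N)%N%:Z) ?dvdz_mull //.
    transitivity (z * N%:Z * (1 - y * (E%:Z * z0))); first by ring.
    by rewrite -xy PoszM; ring.
  - by rewrite mulrA dvdz_mulr.
  - by rewrite mulrAC dvdz_mull.
have aw t : weight (f t - f t0 *~ a t) = weight (f t) - a t * weight (f t0).
  by rewrite raddfB raddfMz /= -mulrzl intz.
have sgM (K : nat) : subgroup (fun x : 'rV[int]_n => (K %| weight x)%Z).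
  by split=> [|u v Ku Kv]; rewrite ?raddf0 ?dvdz0 // raddfB rpredB.
have fz z : ((c * N)%N %| weight (f t0 *~ z))%Z <-> (c %| z)%Z.
  rewrite raddfMz /= -mulrzl intz z0E PoszM mulrA.
  rewrite [X in is_true X](_ : _ = (c %| z * z0)%Z); last first.
    by rewrite !dvdzE !abszM !absz_nat dvdn_pmul2r.
  by rewrite Gauss_dvdzl //; move: cop; rewrite coprimezMr => /andP[].
have c_r : (c %| r t0)%N.
  have := LM _ (decomposition_dvd dec Bt0); rewrite pmulrn.
  by move/fz.
have dec' := decomposition_step (sgM (c * N)%N) LM _ Bt0 c0 fz _ _ dec.
exists (fun t => if t == t0 then f t0 *+ c else f t - f t0 *~ a t); split.
- apply: dec' => [u|t Bt tt0|t Bt tt0].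
  + by apply: dvdz_trans; rewrite dvdzE dvdn_mull.
  + by rewrite aw; have [] := aP t Bt tt0.
  + by have [] := aP t Bt tt0.
- exact: c_r.
- move=> t Bt tt0 cNt; rewrite (negPf tt0).
  by have [_ _ ->] := aP t Bt tt0; rewrite // mulr0z subr0.
- by rewrite eqxx raddfMn /= -mulr_natl natz.
move=> t Bt tt0; rewrite (negPf tt0) aw addrAC subrr add0r rpredN dvdz_mulr //.
by have [] := aP t Bt tt0.
Qed.

(** * Lifting the exponent and orders of orbits *)

Section LiftingTheExponent.
Variable p : nat.
Hypothesis p_pr : prime p.

Lemma dvd_expp_sub1 i (x : int) : (0 < i)%N -> ((p ^ i)%N %| x - 1)%Z ->
  ((p ^ i.+1)%N %| x ^+ p - 1)%Z.
Proof.
move=> i0 px; rewrite subrX1 expnSr PoszM dvdz_mul //.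
have {}px : (p %| x - 1)%Z.
  by apply: dvdz_trans px; rewrite dvdzE -{1}(expn1 p) dvdn_exp2l.
have -> : \sum_(j < p) x ^+ j = \sum_(j < p) (x ^+ j - 1) + p%:Z.
  by rewrite sumrB sumr_const card_ord natz subrK.
rewrite rpredD ?dvdzz //; apply: rpred_sum => j _.
by rewrite subrX1 dvdz_mulr.
Qed.

Lemma dvd_exp_expp_sub1 i s (x : int) : (0 < i)%N -> ((p ^ i)%N %| x - 1)%Z ->
  ((p ^ (i + s))%N %| x ^+ (p ^ s) - 1)%Z.
Proof.
move=> i0 px; elim: s => [|s IH]; first by rewrite addn0.
by rewrite addnS expnSr exprM dvd_expp_sub1 // addn_gt0 i0.
Qed.

(** The cofactor 1 + x + ... + x^(p-1) of x - 1 in x^p - 1 is p times a number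
    congruent to 1 modulo p. For p = 2 this needs x = 1 modulo 4. *)
Lemma expp_sub1_dvd (x : int) j : (p %| x - 1)%Z ->
  (p = 2%N -> (4 %| x - 1)%Z) ->
  ((p ^ j)%N %| x ^+ p - 1)%Z -> ((p ^ j)%N %| (x - 1) * p%:Z)%Z.
Proof.
move=> px p2; rewrite subrX1; set S := \sum_(i < p) x ^+ i.
(* Expand each x^i to first order in x - 1; the linear terms add up to C(p, 2). *)
have [S' SE] : exists S', S = p%:Z * (1 + p%:Z * S').
  have [z zE] : exists z, S = p%:Z + (x - 1) * 'C(p, 2)%:Z + (x - 1) ^+ 2 * z.
    have xiE i : exists z, x ^+ i = 1 + (x - 1) * i%:Z + (x - 1) ^+ 2 * z.
      elim: i => [|i [z zE]]; first by exists 0; rewrite expr0; ring.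
      exists (i%:Z + x * z); rewrite exprS zE -[i.+1]addn1 PoszD.
      by ring.
    have [z zP] := choice xiE.
    exists (\sum_(i < p) z i); rewrite /S; under eq_bigr do rewrite zP.
    rewrite !big_split /= sumr_const card_ord natz -!mulr_sumr;
      congr (_ + _ * _ + _).
    by rewrite -bin2_sum big_mkord -natz natr_sum; apply: eq_bigr => i _;
      rewrite natz.
  have [y yE] := dvdzP px.
  have [w wE] : exists w, (x - 1) * 'C(p, 2)%:Z = p%:Z ^+ 2 * w.
    have [pE|p_odd] := eqVneq p 2%N.
      have [w wE] := dvdzP (p2 pE); exists w; rewrite pE /= wE binn; ring.
    have /dvdnP[b ->] : (p %| 'C(p, 2))%N.
      by apply: prime_dvd_bin => //=; rewrite ltn_neqAle eq_sym p_odd prime_gt1.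
    by exists (y * b%:Z); rewrite yE PoszM; ring.
  exists (w + y ^+ 2 * z); rewrite zE wE yE.
  by ring.
rewrite SE mulrA (@Gauss_dvdzl _ _ (1 + p%:Z * S')) //.
rewrite coprimezE absz_nat; apply: coprimeXl; rewrite -[p in coprime p _]absz_nat.
rewrite -coprimezE; apply/coprimezP; exists (- S', 1).
by rewrite /= mulNr addrC mul1r mulrC addrK.
Qed.

Lemma exp_expp_sub1_dvd (x : int) s j : (p %| x - 1)%Z ->
  (p = 2%N -> (0 < s)%N -> (4 %| x - 1)%Z) ->
  ((p ^ j)%N %| x ^+ (p ^ s) - 1)%Z -> ((p ^ j)%N %| (x - 1) * (p ^ s)%N%:Z)%Z.
Proof.
move=> px; elim: s j => [|s IH] j p2; first by rewrite expr1 mulr1.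
case: j => [|j]; first by rewrite expn0 dvd1z.
set X := x ^+ (p ^ s); rewrite expnSr exprM -/X => pX.
have Xx : (x - 1 %| X - 1)%Z by rewrite /X (subrX1 x) dvdz_mulr.
have : ((p ^ j.+1)%N %| (X - 1) * p%:Z)%Z.
  apply: expp_sub1_dvd pX => [|p2']; first exact: dvdz_trans Xx.
  by apply: dvdz_trans Xx; apply: p2.
rewrite expnSr !PoszM mulrA !dvdzE !abszM !absz_nat !dvdn_pmul2r ?prime_gt0 //.
rewrite -[X in (_ %| _ * X)%N]absz_nat -abszM => pj.
by apply: IH => // p2' _; apply: p2.
Qed.

End LiftingTheExponent.

Section OrbitOrders.
Variables (d m : nat) (m_gt0 : (0 < m)%N).
Hypothesis cmd : coprime m d.
Local Notation tau := (@mulNd d m).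
Local Notation D := (- d%:Z : int).

Lemma iter_fixed l (v : 'I_m) :
  iter l tau v = v <-> (m %| (D ^+ l - 1) * (v : nat)%:Z)%Z.
Proof.
rewrite -{1 2}(residue_ord m_gt0 v) iter_tau mulrBl mul1r -eqz_mod_dvd.
by rewrite -residue_eq; split=> [->|/eqP].
Qed.

Lemma order_dvdn l (v : 'I_m) : iter l tau v = v -> (fingraph.order tau v %| l)%N.
Proof.
have inj := mulNd_inj m_gt0 cmd.
set o := fingraph.order tau v => lv.
(* Reduce the exponent modulo the orbit length. *)
have ov j : iter (j * o) tau v = v.
  by elim: j => //= j IH; rewrite mulSn iterD IH iter_order.
have : iter (l %% o) tau v = v.
  by rewrite -{2}lv {2}(divn_eq l o) addnC iterD ov.
move/(congr1 (findex tau v)); rewrite findex0 findex_iter => [l0|].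
  by rewrite /dvdn l0.
by rewrite ltn_mod fingraph.order_gt0.
Qed.

Lemma dvd_order_exp (v : 'I_m) :
  (m %| (D ^+ fingraph.order tau v - 1) * (v : nat)%:Z)%Z.
Proof. by apply/iter_fixed/iter_order/mulNd_inj. Qed.

Lemma order_exp_local p a s (v : 'I_m) : prime p -> (p ^ a %| m)%N -> (s <=
  a)%N ->
  ~~ (p ^ s.+1 %| v)%N ->
  ((p ^ (a - s))%N %| D ^+ fingraph.order tau v - 1)%Z.
Proof.
move=> p_pr pa sa pv.
have : ((p ^ a)%N %| (D ^+ fingraph.order tau v - 1) * (v : nat)%:Z)%Z.
  by apply: dvdz_trans (dvd_order_exp v); rewrite dvdzE.
rewrite !dvdzE abszM !absz_nat; set X := `|_|%N.
have [->|X0] := posnP X; first by rewrite dvdn0.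
have v0 : (0 < v)%N by rewrite lt0n; apply: contra pv => /eqP->; rewrite dvdn0.
rewrite !pfactor_dvdn ?muln_gt0 ?X0 // lognM // in pv *.
by move=> h; lia.
Qed.

(** Comparison of the p-parts of the orders attached to u = m / p^a and to v,
    where p^s is the exact power of p in v. Since (-d)^o(v) = 1 modulo p^(a-s),
    the order o(u) of -d modulo p^a divides o(v) p^s, and raising (-d)^o(v) to the
    power p^s multiplies the p-part of (-d)^o(v) - 1 by p^s exactly; for p = 2
    and s > 0 this requires (-d)^o(v) = 1 modulo 4. *)
Lemma orbit_exponent_local p a s j (u v : 'I_m) : prime p ->
  (p ^ a %| m)%N -> (u : nat) = (m %/ p ^ a)%N -> (s < a)%N ->
  ~~ (p ^ s.+1 %| v)%N ->
  (p = 2%N -> (0 < s)%N -> (4 %| D ^+ fingraph.order tau v - 1)%Z) ->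
  ((p ^ j)%N %| D ^+ fingraph.order tau u - 1)%Z ->
  ((p ^ j)%N %| (D ^+ fingraph.order tau v - 1) * (p ^ s)%N%:Z)%Z.
Proof.
move=> p_pr pa uE sa pv p2 pj; set x := D ^+ _ in p2 *.
have px := order_exp_local p_pr pa (ltnW sa) pv.
have as0 : (0 < a - s)%N by rewrite subn_gt0.
apply: exp_expp_sub1_dvd => //.
  by apply: dvdz_trans px; rewrite dvdzE -{1}(expn1 p) dvdn_exp2l.
apply: dvdz_trans pj _.
have /dvdnP[y oE] : (fingraph.order tau u %| fingraph.order tau v * p ^ s)%N.
  apply/order_dvdn/iter_fixed; rewrite exprM -/x uE.
  have := dvd_exp_expp_sub1 s as0 px; rewrite subnK ?(ltnW sa) // => /dvdzP[z ->].
  by rewrite -mulrA -PoszM mulnC divnK // dvdz_mull.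
by rewrite /x -exprM oE mulnC exprM [X in (_ %| X)%Z]subrX1 dvdz_mulr.
Qed.

End OrbitOrders.

Local Close Scope ring_scope.

Local Open Scope ring_scope.

(** * The quotients of prime power order prime to d *)

Lemma dvdn_mul_part p r x : prime p ->
  (forall j, (p ^ j %| r)%N -> (p ^ j %| x)%N) -> (r %| x * r`_p^')%N.
Proof.
move=> p_pr H; have [r0|r0] := posnP r.
  have [->|x0] := posnP x; first by rewrite mul0n dvdn0.
  have /(dvdn_leq x0) : (p ^ x %| x)%N by apply: H; rewrite r0 dvdn0.
  by rewrite leqNgt ltn_expl ?prime_gt1.
rewrite -{1}(partnC p r0) dvdn_pmul2r ?part_gt0 // p_part.
by apply: H; rewrite -p_part dvdn_part.
Qed.

Section PrimeStages.
Variables (n d k : nat) (n_gt0 : (0 < n)%N).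
Hypothesis g_k : kautz_g n d k = 1%N.
Variable s : 'I_n -> 'I_n.
Hypothesis sP : deep_section d k s.
Local Notation m := (kautz_n n d k).
Variable V : {set 'I_m}.
Hypothesis V_reps : orbit_representatives d V.
Local Notation q := (gcdn n (d ^ k)).
Local Notation tau_m := (@mulNd d m).
Local Notation rel := (kautz_relation d n_gt0).
Local Notation supp := (kautz_support s V).
Local Notation gen := (@kautz_generator n d k n_gt0 s).
Local Notation expo := (@kautz_exponent n d k).
Local Notation D := (- d%:Z : int).

Let m_gt0 : (0 < m)%N := kautz_n_gt0 d n_gt0 k.

Lemma weight_top_generator i y : supp (inl (i, y)) ->
  (kautz_n n d i.+1 %| weight (gen (inl (i, y))))%Z.
Proof.
move=> By; have [yi yi1 ytop] := topP By; have ik := ltn_ord i.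
rewrite /weight raddfB /= !functional_point !residue_ord.
rewrite -[s (iter i s _)]/(iter i.+1 s (mulNd d y)) -[(_ %/ _)%N]/(kautz_n n d
  i.+1).
have ty : level d i.+1 (mulNd d y) by apply: level_tau.
apply: iter_tau_inj => //.
by rewrite iterS !(iter_tau_section sP) ?subnn //; move: ik; clear; lia.
Qed.

(** The situation after the primes dividing N have been treated: the summand of v
    has lost the factor C v, and modulo n / N its generator still has the weight
    of C v times the original one, which is all that the remaining primes see. *)
Definition prime_stage (N : nat) (C : 'I_m -> nat) (f : kautz_index n d k ->
  'rV[int]_n)
    (r : kautz_index n d k -> nat) : Prop :=
  [/\ decomposes (fun x => (N %| weight x)%Z) rel supp f r,
    forall iy, supp (inl iy) -> f (inl iy) = gen (inl iy),
    forall iy, r (inl iy) = expo (inl iy),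
    forall v, v \in V -> (r (inr v) * C v)%N = expo (inr v)
  & forall v, v \in V ->
      ((n %/ N)%N %| weight (f (inr v)) - (C v * (q * v))%N%:Z)%Z].

Lemma prime_stage1 : prime_stage 1 (fun=> 1%N) gen expo.
Proof.
split=> // [||v vV].
- have := initial_decomposition n_gt0 g_k sP V_reps.
  by case=> H1 H2 H3; split=> //; move=> *; rewrite ?dvd1z //; apply: H2.
- by move=> v vV; rewrite muln1.
rewrite divn1 mul1n -eqz_mod_dvd; apply/eqP; exact: weight_point.
Qed.

Section OneStep.
Variables (N : nat) (C : 'I_m -> nat) (f : kautz_index n d k -> 'rV[int]_n)
  (r : kautz_index n d k -> nat).
Hypothesis stage : prime_stage N C f r.
Variable p : nat.
Hypothesis p_pr : prime p.
Local Notation a := (logn p m).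
Hypothesis a_gt0 : (0 < a)%N.
Hypothesis N_m : (p ^ a * N %| m)%N.
Hypothesis p_N : coprime p N.
Hypothesis p_C : forall v, v \in V -> coprime p (C v).

Let nE : n = (m * q)%N. Proof. by rewrite kautz_n_gcd. Qed.

Let p_q : coprime p q.
Proof.
apply: coprime_dvdl (coprime_gcd_exp g_k).
by apply: dvdn_trans (pfactor_dvdnn p m); rewrite dvdn_exp.
Qed.

Let N_gt0 : (0 < N)%N.
Proof. by have := dvdn_gt0 m_gt0 N_m; rewrite muln_gt0 => /andP[]. Qed.

Let N_n : (p ^ a * N %| n)%N.
Proof. by rewrite [X in (_ %| X)%N]nE dvdn_mulr. Qed.

(** The modulus to which the weights of the generators are still known afterwards. *)
Definition cofactor_modulus : nat := (n %/ (p ^ a * N))%N.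
Local Notation E := cofactor_modulus.

Let nEN : n = (E * p ^ a * N)%N.
Proof. by rewrite -mulnA divnK. Qed.

Let nN : (n %/ N = E * p ^ a)%N.
Proof. by rewrite {1}nEN mulnK. Qed.

Lemma coprime_cofactor : coprime p E.
Proof.
have n0 : (n != 0)%N by rewrite -lt0n.
have E0 : (0 < E)%N by rewrite divn_gt0 ?(dvdn_leq n_gt0) // muln_gt0 N_gt0
  expn_gt0 prime_gt0.
have p0 : (0 < p ^ a)%N by rewrite expn_gt0 prime_gt0.
have q0 : (0 < q)%N by rewrite gcdn_gt0 n_gt0.
have := congr1 (logn p) nE; rewrite {1}nEN !lognM ?muln_gt0 ?E0 ?p0 //.
rewrite pfactorK // (logn_coprime p_q) (logn_coprime p_N) !addn0.
move=> lE; rewrite prime_coprime // -[p in (p %| _)%N]expn1 pfactor_dvdn //.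
by lia.
Qed.

Lemma weight_orbit_generator v e : v \in V -> (e <= a)%N -> (p ^ e %| v)%N ->
  ((p ^ e)%N %| weight (f (inr v)))%Z.
Proof.
have [_ _ _ _ wf] := stage.
move=> vV ea pv; rewrite -(subrK (C v * (q * v))%N%:Z (weight _)) rpredD //.
  apply: dvdz_trans (wf v vV); rewrite nN dvdzE !absz_nat.
  by rewrite dvdn_mull // dvdn_exp2l.
by rewrite dvdzE !absz_nat !dvdn_mull.
Qed.

Lemma stage_dvd t : supp t -> (N %| weight (f t))%Z.
Proof. by have [[H _ _] _ _ _ _] := stage; apply: H. Qed.

Lemma orbit_generator_dvd v e : v \in V -> (e <= a)%N -> (p ^ e %| v)%N ->
  ((p ^ e * N)%N %| weight (f (inr v)))%Z.
Proof.
move=> vV ea pv; rewrite PoszM Gauss_dvdz.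
  by rewrite weight_orbit_generator // stage_dvd.
by rewrite coprimezE !absz_nat coprimeXl.
Qed.

Lemma top_generator_dvd iy : supp (inl iy) ->
  ((p ^ a * N)%N %| weight (f (inl iy)))%Z.
Proof.
have [_ fl _ _ _] := stage.
move=> By; rewrite fl //; case: iy By => i y By.
apply: dvdz_trans (weight_top_generator By); rewrite dvdzE !absz_nat.
by apply: dvdn_trans N_m _; apply: kautz_n_dvd.
Qed.

Lemma orbit_generator_unit v e : v \in V -> (e < a)%N -> logn p v = e -> (0 <
  v)%N ->
  exists2 z : int, weight (f (inr v)) = z * (p ^ e * N)%N%:Z & coprimez p z.
Proof.
move=> vV ea ve v0; have [_ _ _ _ wf] := stage.
have pv : (p ^ e %| v)%N by rewrite pfactor_dvdn // ve.
have /dvdzP[z zE] := orbit_generator_dvd vV (ltnW ea) pv.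
exists z => //; rewrite coprimezE absz_nat prime_coprime //.
apply/negP => pz.
have : ((p ^ e.+1)%N %| weight (f (inr v)))%Z.
  have /dvdzP[z' z'E] : (p %| z)%Z by [].
  apply/dvdzP; exists (z' * N%:Z); rewrite zE z'E expnS !PoszM.
  by ring.
rewrite -[weight _](subrK (C v * (q * v))%N%:Z) rpredDl; last first.
  apply: dvdz_trans (wf v vV); rewrite nN dvdzE !absz_nat.
  by rewrite dvdn_mull // dvdn_exp2l.
rewrite dvdzE !absz_nat Gauss_dvdr; last by rewrite coprimeXl // p_C.
rewrite Gauss_dvdr; last by rewrite coprimeXl.
by rewrite pfactor_dvdn // ve ltnn.
Qed.

(** The divisibility required by [weight_step], with the factor E chosen to absorb
    the part of the order of u prime to p; the p-part is
    [orbit_exponent_local]. *)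
Lemma orbit_local_condition u v t : u \in V -> v \in V ->
  (u : nat) = (m %/ p ^ a)%N -> (logn p v = t)%N -> (0 < v)%N -> (t < a)%N ->
  (p = 2%N -> (0 < t)%N -> (4 %| D ^+ fingraph.order tau_m v - 1)%Z) ->
  exists2 z, weight (f (inr v)) = z * N%:Z &
   (r (inr u) %| (r (inr v))%:Z * (z * (E * (r (inr u))`_p^')%N%:Z))%Z.
Proof.
move=> uV vV uE vt v0 ta p2; have [_ _ _ rC _] := stage.
have pv : (p ^ t %| v)%N by rewrite pfactor_dvdn // vt.
have /dvdzP[z zE] := orbit_generator_dvd vV (ltnW ta) pv.
exists (z * (p ^ t)%N%:Z); first by rewrite zE PoszM mulrA.
rewrite dvdzE !abszM !absz_nat !mulnA; apply: dvdn_mul_part => // j pj.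
apply: dvdn_mulr; rewrite mulnAC; apply: dvdn_mulr.
have := orbit_exponent_local m_gt0 (kautz_coprime g_k) (j := j) p_pr
  (pfactor_dvdnn p m) uE ta.
move=> /(_ v); rewrite pfactor_dvdn // vt ltnn => /(_ isT p2).
rewrite !dvdzE abszM !absz_nat.
have /= := rC u uV; move=> <-; rewrite dvdn_mulr // => /(_ isT).
have /= := rC v vV; move=> <-; rewrite mulnAC Gauss_dvdl // coprimeXl //.
exact: p_C.
Qed.

Let E_dvd v : v \in V -> (E %| weight (f (inr v)) - (C v * (q * v))%N%:Z)%Z.
Proof.
move=> vV; have [_ _ _ _ wf] := stage.
by apply: dvdz_trans (wf v vV); rewrite nN dvdzE !absz_nat dvdn_mulr.
Qed.

Let V_gt0 v : v \in V -> (0 < v)%N.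
Proof. by move=> vV; rewrite lt0n; apply/eqP; have [H _] := V_reps; apply: H. Qed.

Variable u : 'I_m.
Hypothesis uV : u \in V.
Hypothesis uE : (u : nat) = (m %/ p ^ a)%N.

Let logn_u : logn p u = 0%N.
Proof. by rewrite uE logn_div ?pfactor_dvdnn // pfactorK // subnn. Qed.

(** One quotient of order p^a, with f_0 the generator at m / p^a. *)
Lemma generic_prime_step : (p = 2%N -> (1 < a)%N -> (4 %| D - 1)%Z) ->
  exists f' r', prime_stage (p ^ a * N)
    (fun v => C v * (if v == u then p ^ a else 1))%N f' r'.
Proof.
move=> p2; have [dec fl rl rC wf] := stage.
pose Eu := (E * (r (inr u))`_p^')%N.
have [z0] := orbit_generator_unit uV a_gt0 logn_u (V_gt0 uV).
rewrite mul1n => z0E pz0.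
have pa0 : (0 < p ^ a)%N by rewrite expn_gt0 prime_gt0.
have pEu : coprime p Eu.
  rewrite coprimeMr coprime_cofactor /=.
  by apply: (@pnat_coprime p); rewrite ?pnat_id // part_pnat.
have [|t Bt tu|f' [dec' c_r same w0 wE]] := @weight_step n d n_gt0 N (p ^ a) Eu
  _ supp f r (inr u) z0 N_gt0 pa0 N_n uV z0E _ _ dec.
- by rewrite coprimezMr !coprimezE !absz_nat !coprimeXl.
- case: t Bt tu => [iy|v] Bt tu; first by left; apply: top_generator_dvd.
  have [av|va] := leqP a (logn p v).
    by left; apply: orbit_generator_dvd => //; rewrite pfactor_dvdn ?V_gt0.
  right; apply: (orbit_local_condition uV _ uE erefl _ va) => //;
    first exact: V_gt0.
  move=> pE t0; apply: dvdz_trans (p2 pE (leq_ltn_trans t0 va)) _.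
  by rewrite [X in (_ %| X)%Z]subrX1 dvdz_mulr.
exists f', (fun t => if t == inr u then r (inr u) %/ p ^ a else r t)%N;
  split=> //.
- by move=> iy Biy; rewrite same //; [apply: fl | apply: top_generator_dvd].
- move=> v vV; rewrite -[inr v == inr u]/(v == u).
  case: eqP => [->|_]; last by rewrite muln1 rC.
  by rewrite [(C u * _)%N]mulnC mulnA divnK // rC.
move=> v vV; rewrite -/E; case: eqP => [->|/eqP vu].
  rewrite w0 [(C u * _)%N]mulnC -mulnA PoszM -mulrBr dvdz_mull //.
  exact: E_dvd.
rewrite muln1 -(subrK (weight (f (inr v))) (weight (f' _))) -addrA rpredD
  ?E_dvd //.
by apply: dvdz_trans (wE (inr v) vV vu); rewrite dvdzE !absz_nat dvdn_mulr.
Qed.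

(** When -d = 3 modulo 4, the orbits of odd length o have (-d)^o - 1 = 2 modulo 4,
    and they only contain v divisible by 2^(a-1). A first quotient of order
    2^(a-1) leaves these generators alone. In the second one, of order 2, the
    generator at h = m / 2 serves as f_0: the 2-part of its order is 2, which
    divides the order of every other generator of a cycle. *)
Lemma special_prime_step (h : 'I_m) : p = 2%N -> (1 < a)%N -> (4 %| D - 3)%Z ->
  h \in V -> (h : nat) = (m %/ 2)%N ->
  exists f' r', prime_stage (p ^ a * N)
    (fun v => C v * (if v == u then 2 ^ a.-1 else if v == h then 2 else 1))%N
      f' r'.
Proof.
move=> pE a1 D4 hV hE; have [dec fl rl rC wf] := stage.
pose b := a.-1; have aE : a = b.+1 by rewrite prednK.
have b0 : (0 < b)%N by rewrite -ltnS -aE.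
pose Eu := (E * (r (inr u))`_p^')%N.
have [z0] := orbit_generator_unit uV a_gt0 logn_u (V_gt0 uV).
rewrite mul1n => z0E pz0.
have pb0 : (0 < p ^ b)%N by rewrite expn_gt0 prime_gt0.
have pE_ (x : nat) : coprime p (E * x`_p^').
  rewrite coprimeMr coprime_cofactor /=.
  by apply: (@pnat_coprime p); rewrite ?pnat_id // part_pnat.
have bN_aN : (p ^ b * N %| p ^ a * N)%N by rewrite dvdn_mul // dvdn_exp2l //
  leq_pred.
have logn_h : logn p h = b.
  have pm : (p %| m)%N.
    by apply: dvdn_trans (pfactor_dvdnn p m); rewrite aE expnS dvdn_mulr.
  by rewrite hE -pE logn_div // [logn p p]logn_prime // eqxx subn1.
have bh : (p ^ b %| h)%N by rewrite pfactor_dvdn ?V_gt0 // logn_h.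
have ba : (b < a)%N by rewrite aE.
have [zh zhE pzh] := orbit_generator_unit hV ba logn_h (V_gt0 hV).
have uh : h != u by apply/eqP => hu; rewrite hu logn_u in logn_h;
  rewrite -logn_h in b0.
have [|t Bt tu|f1 [dec1 c_r same w0 wE]] := @weight_step n d n_gt0 N (p ^ b) Eu
  _ supp f r (inr u) z0 N_gt0 pb0 (dvdn_trans bN_aN N_n) uV z0E _ _ dec.
- by rewrite coprimezMr !coprimezE !absz_nat !coprimeXl ?pE_.
- case: t Bt tu => [iy|v] Bt tu.
    by left; apply: dvdz_trans (top_generator_dvd Bt); rewrite dvdzE !absz_nat.
  have [bv|vb] := leqP b (logn p v).
    left; apply: orbit_generator_dvd => //; first exact: ltnW.
    by rewrite pfactor_dvdn ?V_gt0.
  right; apply: (orbit_local_condition uV _ uE erefl _ (ltn_trans vb ba)) =>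
    //; first exact: V_gt0.
  move=> _ _; apply: dvdz_trans (order_exp_local m_gt0 (kautz_coprime g_k) p_pr
    (pfactor_dvdnn p m) (ltnW (ltn_trans vb ba)) _).
    rewrite dvdzE absz_nat [X in (X %| _)%N](_ : _ = p ^ 2)%N; last by rewrite pE.
    by apply: dvdn_exp2l; move: vb ba; clear; lia.
  by rewrite pfactor_dvdn ?V_gt0 // ltnn.
set r1 := fun t => if _ then _ else _ in dec1.
have N1 : (0 < p ^ b * N)%N by rewrite muln_gt0 pb0.
have cN1 : (2 * (p ^ b * N) = p ^ a * N)%N by rewrite mulnA -{1}pE -expnS -aE.
have f1h : f1 (inr h) = f (inr h).
  by apply: same => //; apply: orbit_generator_dvd => //; apply: ltnW.
have f1l iy : supp (inl iy) -> f1 (inl iy) = f (inl iy).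
  move=> Biy; apply: same => //.
  by apply: dvdz_trans (top_generator_dvd Biy); rewrite dvdzE !absz_nat.
pose E2 := (E * (r1 (inr h))`_p^')%N.
have d_odd : odd d.
  by case/dvdzP: D4; clear=> y yE; lia.
have D2 : (2 %| D - 1)%Z.
  case/dvdzP: D4; clear=> y yE; apply/dvdzP; exists (2 * y + 1).
  by rewrite -[D](subrK 3) yE; ring.
have expo_even v : v \in V -> (p %| r1 (inr v))%N.
  move=> vV; rewrite /r1 -[inr v == inr u]/(v == u); case: eqP => [vu|_].
    have : (p ^ a %| r (inr u) * C u)%N.
      have := order_exp_local m_gt0 (kautz_coprime g_k) p_pr (pfactor_dvdnn p
        m) (leq0n a) (v := u).
      rewrite pfactor_dvdn ?V_gt0 // logn_u subn0 => /(_ isT).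
      by rewrite dvdzE absz_nat (rC u uV).
    rewrite Gauss_dvdl ?coprimeXl ?p_C // aE expnS.
    have /dvdnP[y ->] := c_r; by rewrite mulnK // dvdn_pmul2r.
  have : (p %| r (inr v) * C v)%N.
    rewrite rC // [X in (X %| _)%N]pE -[X in (X %| _)%N]/`|2%:Z|%N -dvdzE.
    by apply: dvdz_trans D2 _; rewrite [X in (_ %| X)%Z]subrX1 dvdz_mulr.
  by rewrite Gauss_dvdl // p_C.
(* Second quotient, of order 2; the generator at h is still the original one. *)
have [|||t Bt th|f2 [dec2 c_r2 same2 w02 wE2]] := @weight_step n d n_gt0 (p ^ b
  * N) 2 E2
  _ supp f1 r1 (inr h) zh N1 isT _ hV _ _ _ dec1.
- by rewrite cN1.
- by rewrite f1h.
- by rewrite coprimezMr !coprimezE !absz_nat -pE pE_.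
- rewrite cN1; case: t Bt th => [iy|v] Bt vh.
    by left; rewrite f1l //; apply: top_generator_dvd.
  right; have [dec1M _ _] := dec1.
  have /dvdzP[z zE] := dec1M _ Bt; exists z => //.
  rewrite dvdzE !abszM !absz_nat !mulnA; apply: dvdn_mul_part => // j pj.
  do 2![apply: dvdn_mulr].
  have {}pj : (p ^ j %| r (inr h))%N by move: pj;
    rewrite /r1 -[inr h == inr u]/(h == u) (negPf uh).
  have {pj} : (p ^ j %| `|D - 1|)%N.
    have /= := rC h hV; have -> : fingraph.order tau_m h = 1%N.
      apply/eqP; rewrite -dvdn1; apply: (order_dvdn m_gt0 (kautz_coprime g_k)).
      apply/(iter_fixed d m_gt0); rewrite expr1.
      case/dvdzP: D2 => y ->; rewrite -mulrA hE -PoszM mulnC divnK ?dvdz_mull //.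
      by rewrite -pE; apply: dvdn_trans (pfactor_dvdnn p m);
        rewrite aE expnS dvdn_mulr.
    by rewrite expr1 => <-; apply: dvdn_mulr.
  case: j => [|[|j]] //; first by rewrite expn1 => _; apply: expo_even.
  move=> pj; have /dvdzP[y yE] : (4 %| D - 1)%Z.
    rewrite dvdzE; apply: dvdn_trans pj;
      rewrite [X in (X %| _)%N](_ : _ = p ^ 2)%N; last by rewrite pE.
    by apply: dvdn_exp2l.
  by case/dvdzP: D4 yE; clear=> y' y'E yE; lia.
set r2 := fun t => if _ then _ else _ in dec2.
exists f2, r2; rewrite cN1 in dec2 same2; split=> //.
- move=> iy Biy; rewrite same2 // f1l //;
  [apply: fl | apply: top_generator_dvd] => //.
- move=> v vV; rewrite /r2 -[inr v == inr h]/(v == h).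
  have [->|vu] := eqVneq v u.
    rewrite eq_sym (negPf uh) (_ : r1 (inr u) = r (inr u) %/ p ^ b)%N; last first.
      by rewrite /r1 eqxx.
    by rewrite -pE [(C u * _)%N]mulnC mulnA divnK // rC.
  have [->|vh] := eqVneq v h.
    rewrite [(C h * _)%N]mulnC mulnA divnK // /r1 -[inr h == inr u]/(h == u).
    by rewrite (negPf uh) rC.
  by rewrite muln1 /r1 -[inr v == inr u]/(v == u) (negPf vu) rC.
have w2 v : v \in V -> v != h -> (E %| weight (f2 (inr v)) - weight (f1 (inr
  v)))%Z.
  by move=> vV vh; apply: dvdz_trans (wE2 (inr v) vV vh);
    rewrite dvdzE !absz_nat dvdn_mulr.
move=> v vV; rewrite -/E; have [->|vu] := eqVneq v u.
  rewrite -(subrK (weight (f1 (inr u))) (weight (f2 _))) -addrA rpredD ?w2 //.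
    by rewrite eq_sym.
  rewrite w0 -pE [(C u * _)%N]mulnC -mulnA PoszM -mulrBr dvdz_mull //.
  exact: E_dvd.
have [->|vh] := eqVneq v h.
  by rewrite w02 f1h [(C h * _)%N]mulnC -mulnA PoszM -mulrBr dvdz_mull // E_dvd.
rewrite muln1 -(subrK (weight (f1 (inr v))) (weight (f2 _))) -addrA rpredD ?w2 //.
rewrite -(subrK (weight (f (inr v))) (weight (f1 _))) -addrA rpredD ?E_dvd //.
by apply: dvdz_trans (wE (inr v) vV vu); rewrite dvdzE !absz_nat dvdn_mulr.
Qed.

End OneStep.
End PrimeStages.

Local Close Scope ring_scope.

Local Open Scope ring_scope.

(** * The quotients supported on the primes dividing d *)

Section LevelStages.
Variables (n d k : nat) (n_gt0 : (0 < n)%N).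
Hypothesis g_k : kautz_g n d k = 1%N.
Variable s : 'I_n -> 'I_n.
Hypothesis sP : deep_section d k s.
Local Notation m := (kautz_n n d k).
Variable V : {set 'I_m}.
Local Notation q := (gcdn n (d ^ k)).
Local Notation tau := (@mulNd d n).
Local Notation rel := (kautz_relation d n_gt0).
Local Notation supp := (kautz_support s V).
Local Notation gen := (@kautz_generator n d k n_gt0 s).
Local Notation residue := (int_residue n_gt0).

(** Take y = s w + n / g_i for w = tau q, where q = gcd(n, d^i). Then y has the
    same image w as s w, and it is not of level i + 1: otherwise s w would be
    too, so that g_i would divide n_(i+1); but s w = q modulo q n_(i+1), so
    that s w would be q modulo q g_i and not of level i + 1. Applying tau^i to
    the generator at (i, y) shows that its weight times (-d)^i is n / g_i
    modulo n. *)
Lemma full_order_generator (i : 'I_k) : (1 < kautz_g n d i)%N ->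
  exists2 y, chain_top d s i y & exists2 z : int,
    weight (gen (inl (i, y))) = z * (kautz_n n d i.+1)%:Z &
    coprimez (kautz_g n d i) z.
Proof.
move=> g1; have ik := ltn_ord i.
set g := kautz_g n d i in g1 *; set q_i := gcdn n (d ^ i).
set n1 := kautz_n n d i.+1; pose e := (q_i * n1)%N.
have n1_gt0 : (0 < n1)%N by apply: kautz_n_gt0.
have q_i_gt0 : (0 < q_i)%N by rewrite gcdn_gt0 n_gt0.
have nE : n = (e * g)%N.
  by rewrite /e -mulnA kautz_nS mulnC kautz_n_gcd.
have gd : (g %| d)%N by apply: dvdn_gcdr.
have g_gt0 : (0 < g)%N by apply: ltnW.
pose w := tau (residue q_i).
have w1 : level d i.+1 w by apply: level_tau => //; rewrite level_residue dvdzz.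
have sw : level d i (s w) by apply: (level_section sP) => //; apply: ltnW.
have tsw : tau (s w) = w by apply: (tau_section sP); apply: levelW w1.
pose y := residue ((s w : nat)%:Z + e%:Z).
have yi : level d i y.
  by rewrite level_residue rpredD // dvdzE !absz_nat dvdn_mulr.
have ty : tau y = w.
  rewrite -[RHS]tsw mulNd_residue [RHS](mulNdE n_gt0); apply/residueP/eqP.
  rewrite eqz_mod_dvd -mulrBr addrAC subrr add0r mulNr rpredN -PoszM dvdzE
    !absz_nat.
  by rewrite [X in (X %| _)%N]nE [(e * g)%N]mulnC dvdn_mul.
have sy : s (tau y) != y.
  rewrite ty -[X in X != _](residue_ord n_gt0) residue_eq eq_sym eqz_mod_dvd.
  rewrite addrAC subrr add0r dvdzE !absz_nat; apply/negP => /dvdn_leq.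
  by rewrite {1}nE muln_gt0 q_i_gt0 n1_gt0 => /(_ isT);
    rewrite leqNgt ltn_Pmulr // muln_gt0 q_i_gt0.
have yi1 : ~~ level d i.+1 y.
  apply/negP => yi1.
  have sw1 : level d i.+1 (s w).
    by apply: (level_section sP) => //; rewrite -ty; apply: level_tau.
  have gn1 : (g %| n1)%N.
    move: yi1; rewrite level_residue rpredDl // dvdzE !absz_nat gcd_expS //.
    by rewrite dvdn_pmul2l.
  have /dvdzP[z zE] : (q_i %| (s w : nat)%:Z - q_i%:Z)%Z.
    by rewrite rpredB ?dvdzz.
  have n1z : (n1 %| z)%Z.
    have : residue (- d%:Z * (s w : nat)%:Z) = residue (- d%:Z * q_i%:Z).
      by rewrite -(mulNdE n_gt0) tsw /w mulNd_residue.
    move/eqP; rewrite residue_eq eqz_mod_dvd -mulrBr zE mulNr rpredN.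
    have /dvdnP[d' dE] := gd.
    (* Cancelling q g_i leaves n_(i+1) and d / g_i, which are coprime. *)
    have cop : coprime n1 d'.
      rewrite /coprime -(eqn_pmul2r g_gt0) mul1n muln_gcdl -dE kautz_nS.
      exact: eqxx.
    rewrite [X in (Posz X %| _)%Z]nE dE !dvdzE !abszM !absz_nat /e.
    rewrite (_ : (q_i * n1 * g = n1 * (g * q_i))%N); last by lia.
    rewrite (_ : (d' * g * (`|z| * q_i) = d' * `|z| * (g * q_i))%N); last by lia.
    rewrite dvdn_pmul2r ?muln_gt0 ?g_gt0 //.
    by rewrite Gauss_dvdr.
  have : (g %| 1 + z)%Z.
    have : ((q_i * g)%N %| (s w : nat)%:Z)%Z by rewrite dvdzE absz_nat -gcd_expS.
    have -> : (s w : nat)%:Z = (1 + z) * q_i%:Z.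
      by rewrite mulrDl mul1r -zE addrC subrK.
    by rewrite !dvdzE abszM !absz_nat mulnC dvdn_pmul2r.
  rewrite rpredDr; last by apply: dvdz_trans n1z; rewrite dvdzE.
  by rewrite dvdzE absz_nat dvdn1; apply/negP; rewrite neq_ltn g1 orbT.
have topy : chain_top d s i y by rewrite /chain_top yi yi1 sy.
exists y => //.
have /dvdzP[z zE] := weight_top_generator n_gt0 sP (V := V) (i := i) (y := y)
  topy.
exists z => //.
have : (n %| (- d%:Z) ^+ i * weight (gen (inl (i, y))) - e%:Z)%Z.
  rewrite /weight raddfB /= !functional_point !residue_ord.
  rewrite -[s (iter i s _)]/(iter i.+1 s (tau y)) mulrBr.
  have h1 : residue ((- d%:Z) ^+ i * (iter i s y : nat)%:Z) = y.
    by rewrite -iter_tau residue_ord (iter_tau_section sP) ?subnn // leqW // ltnW.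
  have h2 : residue ((- d%:Z) ^+ i * (iter i.+1 s (tau y) : nat)%:Z) = s w.
    by rewrite -iter_tau residue_ord ty (iter_tau_section sP) ?subSnn // ltnW.
  have {}h1 : (n %| (- d%:Z) ^+ i * (iter i s y : nat)%:Z - ((s w : nat)%:Z +
    e%:Z))%Z.
    by rewrite -eqz_mod_dvd -(residue_eq n_gt0) h1.
  have {}h2 : (n %| (- d%:Z) ^+ i * (iter i.+1 s (tau y) : nat)%:Z - (s w :
    nat)%:Z)%Z.
    by rewrite -eqz_mod_dvd -(residue_eq n_gt0) h2 residue_ord.
  have eqr (a c x b : int) : a - c - b = (a - (x + b)) - (c - x) by ring.
  by rewrite (eqr _ _ (s w : nat)%:Z) rpredB.
rewrite zE -/n1.
have /dvdnP[d' dE] : (q_i %| d ^ i)%N by apply: dvdn_gcdr.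
have -> : (- d%:Z) ^+ i = (-1) ^+ i * d'%:Z * q_i%:Z.
  by rewrite [LHS]exprNn -mulrA -PoszM -dE -[d%:Z]natz -natrX natz.
rewrite (_ : _ - _ = ((-1) ^+ i * d'%:Z * z - 1) * e%:Z);
  last by rewrite /e PoszM; ring.
rewrite [X in (Posz X %| _)%Z]nE dvdzE absz_nat abszM absz_nat [(e * g)%N]mulnC.
rewrite dvdn_pmul2r ?muln_gt0 ?q_i_gt0 // => gz.
have /dvdzP[x xE] : (g %| (-1) ^+ i * d'%:Z * z - 1)%Z by rewrite dvdzE absz_nat.
apply/coprimezP; exists (- x, (-1) ^+ i * d'%:Z) => /=.
by rewrite mulNr -xE opprB subrK.
Qed.

Variable Y : 'I_k -> 'I_n.
Hypothesis Y_top : forall i : 'I_k, chain_top d s i (Y i).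
Hypothesis Y_weight : forall i : 'I_k, exists2 z : int,
  weight (gen (inl (i, Y i))) = z * (kautz_n n d i.+1)%:Z &
  coprimez (kautz_g n d i) z.

(** The orders of the tree summands once the levels from j on have been treated. *)
Definition top_order (j : nat) (iy : 'I_k * 'I_n) : nat :=
  if (j <= iy.1)%N && (iy.2 == Y iy.1) then (d ^ iy.1.+1 %/ kautz_g n d iy.1)%N
  else (d ^ iy.1.+1)%N.

Lemma dvdn_top_order j (iy : 'I_k * 'I_n) : (d ^ iy.1 %| top_order j iy)%N.
Proof.
rewrite /top_order; case: ifP => _; last by rewrite dvdn_exp2l.
have /dvdnP[y dE] : (kautz_g n d iy.1 %| d)%N by apply: dvdn_gcdr.
rewrite expnSr -muln_divA; first by rewrite dvdn_mulr.
by rewrite dvdn_gcdr.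
Qed.

(** Going from n_(j+1) to n_j, the generators of levels below j already have weight
    divisible by n_j, and the orders at the levels from j on are multiples of
    d^(j+1), the order of the generator used at level j. *)
Lemma level_stages f r :
  decomposes (fun x => (m %| weight x)%Z) rel supp f r ->
  (forall iy, supp (inl iy) -> f (inl iy) = gen (inl iy)) ->
  (forall iy : 'I_k * 'I_n, r (inl iy) = (d ^ iy.1.+1)%N) ->
  (forall v, v \in V -> (n %| weight (f (inr v)))%Z) ->
  forall e, (e <= k)%N -> exists f' r',
    [/\ decomposes (fun x => (kautz_n n d (k - e) %| weight x)%Z) rel supp f' r',
     forall iy : 'I_k * 'I_n, supp (inl iy) -> (iy.1 < k - e)%N -> f' (inl iy)
       = gen (inl iy),
     forall iy, r' (inl iy) = top_order (k - e) iy,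
     forall v, v \in V -> f' (inr v) = f (inr v)
     & forall v, r' (inr v) = r (inr v)].
Proof.
move=> dec fl rl fV; elim=> [_|e IH ek].
  exists f, r; rewrite subn0; split=> // [iy By _|iy]; first exact: fl.
  by rewrite /top_order leqNgt ltn_ord rl.
have [f1 [r1 [dec1 f1l r1l f1V r1V]]] := IH (ltnW ek).
pose j := (k - e.+1)%N;
  have jE : (k - e = j.+1)%N by rewrite /j subnS prednK // subn_gt0.
have jk : (j < k)%N by rewrite -jE leq_subr.
rewrite -/j; rewrite jE in dec1 f1l r1l.
pose J := Ordinal jk; have BJ : supp (inl (J, Y J)) := Y_top J.
have [z wJ zcop] := Y_weight J.
have n1_gt0 : (0 < kautz_n n d j.+1)%N by apply: kautz_n_gt0.
have cNE : (kautz_g n d j * kautz_n n d j.+1 = kautz_n n d j)%N by rewrite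
  mulnC kautz_nS.
have top_dvd i y : supp (inl (i, y)) -> (i < j)%N ->
    (kautz_n n d j %| weight (f1 (inl (i, y))))%Z.
  move=> By ij; rewrite f1l //; last exact: leqW.
  apply: dvdz_trans (weight_top_generator n_gt0 sP By).
  by rewrite dvdzE !absz_nat kautz_n_dvd.
have orb_dvd v : v \in V -> (kautz_n n d j %| weight (f1 (inr v)))%Z.
  move=> vV; rewrite f1V //; apply: dvdz_trans (fV v vV).
  by rewrite dvdzE !absz_nat; apply: (kautz_n_dvd n d (leq0n j)).
have [|||t Bt tJ|f2 [dec2 _ same _ _]] := @weight_step n d n_gt0 (kautz_n n d
  j.+1)
  (kautz_g n d j) 1 _ supp f1 r1 (inl (J, Y J)) z n1_gt0 (kautz_g_gt0 d n_gt0 j)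
  _ BJ _ _ _ dec1.
- by rewrite cNE; apply: (kautz_n_dvd n d (leq0n j)).
- by rewrite f1l.
- by rewrite mul1r.
- rewrite cNE; case: t Bt tJ => [[i y]|v] Bt tJ; last by left; apply: orb_dvd.
  case: (ltnP i j) => [ij|ji]; first by left; apply: top_dvd.
  right; have [dec1M _ _] := dec1; have /dvdzP[z' z'E] := dec1M _ Bt.
  exists z' => //; rewrite mulr1 dvdz_mulr // dvdzE !absz_nat !r1l.
  rewrite {1}/top_order /= ltnn /=.
  move: ji; rewrite leq_eqVlt => /orP[/eqP ij|ij].
    by rewrite /top_order /= -ij ltnn /= dvdnn.
  by apply: dvdn_trans (dvdn_top_order _ _); rewrite dvdn_exp2l.
rewrite cNE in dec2 same.
exists f2, (fun t => if t == inl (J, Y J) then r1 (inl (J, Y J)) %/ kautz_g n d j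
  else r1 t)%N; split=> //.
- move=> [i y] Biy /= ij; rewrite same //; first by apply: f1l => //; apply: leqW.
    by apply/eqP => -[iE _]; rewrite iE ltnn in ij.
  exact: top_dvd.
- move=> [i y]; rewrite -[inl (i, y) == _]/((i, y) == (J, Y J)) xpair_eqE !r1l.
  rewrite /top_order /= ltnn /= -val_eqE /=.
  have [ij|ij|ij] := ltngtP j i => //=.
  have iJ : i = J by apply/val_inj; rewrite /= ij.
  by rewrite iJ.
- by move=> v vV; rewrite same ?f1V //; rewrite -?f1V //; apply: orb_dvd.
Qed.

End LevelStages.

Local Close Scope ring_scope.

(** * Assembling the prime factors *)

Section PrimeFactors.
Variables (d m : nat).
Hypotheses (m_gt0 : 0 < m) (cmd : coprime m d).

Definition exceptional_at_2 : bool := (4 %| m) && (- d%:Z == 3 %[mod 4])%Z.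

(** The contribution of the prime p to c'(v); the product over p is c'(v) because
    at most one factor differs from 1. *)
Definition prime_factor (p v : nat) : nat :=
  if (p == 2) && exceptional_at_2 then
    if v == m %/ m`_2 then m`_2 %/ 2 else if v == m %/ 2 then 2 else 1
  else if v == m %/ m`_p then m`_p else 1.

Lemma part_eq p x : 0 < x -> x %| m ->
  m %/ m`_p = m %/ x -> x = m`_p.
Proof.
move=> x0 xm E; have P0 := part_gt0 p m.
apply/eqP; rewrite -(eqn_pmul2l (_ : 0 < m %/ x)) ?divn_gt0 ?(dvdn_leq m_gt0) //.
by rewrite divnK // -E divnK ?dvdn_part.
Qed.

Lemma part_inj p p' : p \in primes m -> p' \in primes m ->
  m %/ m`_p = m %/ m`_p' -> p = p'.
Proof.
move=> pm p'm /(part_eq (part_gt0 _ _) (dvdn_part _ _)).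
rewrite !p_part; move: pm p'm;
  rewrite !mem_primes m_gt0 /= => /andP[p_pr pm] /andP[p'_pr p'm] E.
have : p %| p' ^ logn p' m.
  by rewrite E dvdn_exp // logn_gt0 mem_primes p_pr m_gt0.
by rewrite Euclid_dvdX // dvdn_prime2 // => /andP[/eqP].
Qed.

Lemma prod_prime_factor v : \prod_(p <- primes m) prime_factor p v = kautz_c d
  m v.
Proof.
have only p : p \in primes m -> (forall p', p' \in primes m -> p' != p ->
  prime_factor p' v = 1) ->
    \prod_(p <- primes m) prime_factor p v = prime_factor p v.
  move=> pm H; rewrite (bigD1_seq p) ?primes_uniq //= big_seq_cond big1 ?muln1 //.
  by move=> p' /andP[]; apply: H.
rewrite /kautz_c andbA -/exceptional_at_2.
have [/andP[sp /eqP vE]|nsp] := boolP (exceptional_at_2 && (v == m %/ 2)).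
  have /andP[m4 _] := sp.
  have m2 : 2 \in primes m.
    by rewrite mem_primes m_gt0 /=; apply: dvdn_trans m4.
  have ne p : p \in primes m -> v != m %/ m`_p.
    move=> pm; apply/eqP; rewrite vE => /esym /(part_eq (isT : 0 < 2)).
    move=> /(_ (dvdn_trans (isT : 2 %| 4) m4)) pE.
    have p2 : p = 2.
      move: pm; rewrite mem_primes => /and3P[p_pr _ pm].
      have : p %| 2 by rewrite pE p_part dvdn_exp // logn_gt0 mem_primes p_pr
        m_gt0.
      by rewrite dvdn_prime2 // => /eqP.
    have : 4 %| m`_2 by rewrite p_part -[4]/(2 ^ 2) dvdn_exp2l // -pfactor_dvdn.
    by rewrite p2 in pE; rewrite -pE.
  rewrite (only 2) //.
    by rewrite /prime_factor eqxx sp /= (negPf (ne 2 m2)) vE eqxx.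
  by move=> p pm p2; rewrite /prime_factor (negPf p2) /= (negPf (ne p pm)).
case E: [seq p : nat <- primes m | v == m %/ m`_p] => [|p l].
  rewrite big_seq big1 // => p pm; rewrite /prime_factor.
  have ne p' : p' \in primes m -> v == m %/ m`_p' = false.
    move=> p'm; apply/negP => vE.
    by have : p' \in [::] by rewrite -E mem_filter vE.
  case: andP => [[/eqP p2 sp]|_]; last by rewrite ne.
  rewrite ne; last by rewrite -p2.
  by case: ifP nsp => // _; rewrite sp.
have : p \in [seq p : nat <- primes m | v == m %/ m`_p] by rewrite E mem_head.
rewrite mem_filter => /andP[/eqP vE pm].
rewrite (only p) // => [|p' p'm p'p]; last first.
  have ne : v == m %/ m`_p' = false.
    by apply/negP; rewrite vE => /eqP /(part_inj pm p'm) pp';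
      rewrite pp' eqxx in p'p.
  rewrite /prime_factor; case: andP => [[/eqP p2 sp]|_]; last by rewrite ne.
  rewrite -p2 ne p2; by case: ifP nsp => // _; rewrite sp.
rewrite /prime_factor vE eqxx.
have [p2|] //= := eqVneq p 2; rewrite p2 eqxx.
have d_odd : odd d.
  move: pm; rewrite p2 mem_primes => /and3P[_ _ /coprime_dvdl/(_ cmd)].
  by rewrite coprime2n.
rewrite /exceptional_at_2; case: (4 %| m) => //=; last by rewrite orbT.
rewrite orbF.
have : (- d%:Z == 1 %[mod 4])%Z != (- d%:Z == 3 %[mod 4])%Z.
  by move: d_odd; clear; lia.
by case: (- d%:Z == 1 %[mod 4])%Z; case: (- d%:Z == 3 %[mod 4])%Z.
Qed.

Lemma prime_factor_dvd p v : prime_factor p v %| p ^ logn p m.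
Proof.
rewrite /prime_factor; case: andP => [[/eqP-> /andP[m4 _]]|_]; last first.
  by rewrite p_part; case: ifP; rewrite ?dvd1n.
have a2 : 1 < logn 2 m by rewrite -pfactor_dvdn.
rewrite p_part; case: ifP => _; last by case: ifP;
  rewrite ?dvd1n // dvdn_exp // ltnW.
by rewrite -{1}(prednK (ltnW a2)) expnS mulKn // dvdn_exp2l // leq_pred.
Qed.

End PrimeFactors.

Section Assembly.
Variables (n d k : nat) (n_gt0 : 0 < n).
Hypothesis g_k : kautz_g n d k = 1.
Variable s : 'I_n -> 'I_n.
Hypothesis sP : deep_section d k s.
Local Notation m := (kautz_n n d k).
Variable V : {set 'I_m}.
Hypothesis V_reps : orbit_representatives d V.
Hypothesis V_prime_powers : contains_prime_power_quotients V.

Let m_gt0 : 0 < m := kautz_n_gt0 d n_gt0 k.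

Lemma prime_stages (Q : seq nat) : uniq Q -> {subset Q <= primes m} ->
  exists f r, prime_stage n_gt0 s V (\prod_(p <- Q) p ^ logn p m)
    (fun v => \prod_(p <- Q) prime_factor d m p v) f r.
Proof.
suff H : uniq Q -> {subset Q <= primes m} -> \prod_(p <- Q) p ^ logn p m %| m /\
  exists f r, prime_stage n_gt0 s V (\prod_(p <- Q) p ^ logn p m)
    (fun v => \prod_(p <- Q) prime_factor d m p v) f r.
  by move=> uQ sQ; have [] := H uQ sQ.
elim: Q => [_ _|p Q IH /= /andP[pQ uQ] sQ].
  rewrite big_nil dvd1n; split=> //.
  have [dec fl rl rC wf] := prime_stage1 n_gt0 g_k sP V_reps.
  exists (kautz_generator n_gt0 s), (@kautz_exponent n d k); split=> // v vV;
    rewrite big_nil.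
    exact: rC.
  exact: wf.
have [|NQ [f [r stage]]] := IH uQ; first by move=> x xQ; apply: sQ;
  rewrite inE xQ orbT.
have pm : p \in primes m by apply: sQ; rewrite mem_head.
have p_pr : prime p by move: pm; rewrite mem_primes => /andP[].
have pnat_ne p' : p' \in Q -> coprime p (p' ^ logn p' m).
  move=> p'Q; rewrite coprimeXr // prime_coprime // dvdn_prime2 //.
    by apply: contraNneq pQ => ->.
  by have : p' \in primes m; [apply: sQ;
    rewrite inE p'Q orbT | rewrite mem_primes => /andP[]].
have pN : coprime p (\prod_(p' <- Q) p' ^ logn p' m).
  by rewrite big_seq; apply: (big_ind (coprime p)) => [|x y px py|p' p'Q];
    rewrite ?coprimen1 ?coprimeMr ?px ?pnat_ne.
have pC v : v \in V -> coprime p (\prod_(p' <- Q) prime_factor d m p' v).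
  move=> _; rewrite big_seq; apply: (big_ind (coprime p)) => [|x y px py|p' p'Q].
  - by rewrite coprimen1.
  - by rewrite coprimeMr px py.
  exact: coprime_dvdr (prime_factor_dvd _ _ _ _) (pnat_ne _ p'Q).
have a_gt0 : 0 < logn p m by rewrite logn_gt0.
have pNm : p ^ logn p m * \prod_(p' <- Q) p' ^ logn p' m %| m.
  by rewrite Gauss_dvd ?coprimeXl // pfactor_dvdnn NQ.
rewrite big_cons; split=> //.
have [u uV uE] := V_prime_powers p_pr a_gt0 (pfactor_dvdnn p m).
suff [f' [r' stage']] : exists f' r', prime_stage n_gt0 s V
    (p ^ logn p m * \prod_(p' <- Q) p' ^ logn p' m)
    (fun v => (\prod_(p' <- Q) prime_factor d m p' v) * prime_factor d m p v)
      f' r'.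
  exists f', r'; have [dec fl rl rC wf] := stage'.
  split=> // v vV; rewrite big_cons [prime_factor _ _ _ _ * _]mulnC;
    first exact: rC.
  exact: wf.
have m_even : p = 2 -> odd d.
  move=> p2; move: pm (kautz_coprime g_k);
    rewrite p2 mem_primes => /and3P[_ _ m2] cmd.
  by rewrite -coprime2n; apply: coprime_dvdl cmd.
have [/andP[/eqP p2 sp]|nsp] := boolP ((p == 2) && exceptional_at_2 d m).
  have /andP[m4 D3] := sp.
  have a1 : 1 < logn p m by rewrite p2 -pfactor_dvdn.
  have m2 : 2 ^ 1 %| m by apply: dvdn_trans m4.
  have [h hV hE] := V_prime_powers (isT : prime 2) (isT : 0 < 1) m2.
  have D4 : (4 %| (- d%:Z - 3)%R)%Z by rewrite -eqz_mod_dvd.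
  have [f' [r' [dec fl rl rC wf]]] :=
    special_prime_step g_k sP V_reps stage p_pr a_gt0 pNm pN pC uV uE p2 a1 D4
      hV hE.
  have facE v : (if v == u then 2 ^ (logn p m).-1 else if v == h then 2 else 1) =
      prime_factor d m p v.
    rewrite /prime_factor p2 eqxx sp /= -!val_eqE /= uE hE p2 p_part.
    have a2 : 0 < logn 2 m by rewrite -p2.
    suff -> : 2 ^ logn 2 m %/ 2 = 2 ^ (logn 2 m).-1 by [].
    by rewrite -{1}(prednK a2) expnS mulKn.
  by exists f', r'; split=> // v vV; rewrite -facE; [apply: rC | apply: wf].
have p2 : p = 2 -> 1 < logn p m -> (4 %| (- d%:Z - 1)%R)%Z.
  move=> p2; rewrite p2 -pfactor_dvdn // => m4; move: nsp (m_even p2).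
  rewrite p2 eqxx /exceptional_at_2 m4 /= => D3 d_odd.
  by rewrite -eqz_mod_dvd; move: D3 d_odd; clear; lia.
have [f' [r' [dec fl rl rC wf]]] :=
  generic_prime_step g_k sP V_reps stage p_pr a_gt0 pNm pN pC uV uE p2.
have facE v : (if v == u then p ^ logn p m else 1) = prime_factor d m p v.
  by rewrite /prime_factor (negPf nsp) -!val_eqE /= uE p_part.
by exists f', r'; split=> // v vV; rewrite -facE; [apply: rC | apply: wf].
Qed.

Lemma prime_stage_full : exists f r,
  prime_stage n_gt0 s V m (fun v => kautz_c d m v) f r.
Proof.
have [f [r [dec fl rl rC wf]]] := prime_stages (primes_uniq m) (fun x xm => xm).
have mE : \prod_(p <- primes m) p ^ logn p m = m.
  by rewrite [RHS](prod_prime_decomp m_gt0) prime_decompE big_map.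
rewrite mE in dec wf; exists f, r; split=> // v vV.
  by rewrite -(prod_prime_factor m_gt0 (kautz_coprime g_k)); apply: rC.
by rewrite -(prod_prime_factor m_gt0 (kautz_coprime g_k)); apply: wf.
Qed.

End Assembly.

(** * The orders in the prescribed order *)

Lemma kautz_c_gt0 d m v : 0 < m -> coprime m d -> 0 < kautz_c d m v.
Proof.
move=> m0 cmd; rewrite -(prod_prime_factor m0 cmd) big_seq.
apply: (big_ind (fun x => 0 < x)) => [|x y x0 y0|p pm] //.
  by rewrite muln_gt0 x0.
apply: dvdn_gt0 _ (prime_factor_dvd d m0 p v).
by rewrite expn_gt0; move: pm; rewrite mem_primes => /andP[/prime_gt0->].
Qed.

Section Enumeration.
Variables (n d k : nat) (n_gt0 : 0 < n).
Hypothesis g_k : kautz_g n d k = 1.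
Variable s : 'I_n -> 'I_n.
Hypothesis sP : deep_section d k s.
Local Notation m := (kautz_n n d k).
Variable V : {set 'I_m}.
Variable Y : 'I_k -> 'I_n.
Hypothesis Y_top : forall i : 'I_k, chain_top d s i (Y i).

(** The generator whose order is divided by g_i comes first in its level, to match
    the shape of [kautz_orders]. *)
Definition kautz_enum : seq (kautz_index n d k) :=
  [seq inl (i, y) | i <- enum 'I_k,
                    y <- Y i :: enum ([set y | chain_top d s i y] :\ Y i)]
  ++ [seq inr v | v <- enum V].

Lemma kautz_enum_uniq : uniq kautz_enum.
Proof.
rewrite cat_uniq map_inj_uniq ?enum_uniq ?andbT; last by move=> v w [].
apply/andP; split.
  apply: allpairs_uniq_dep => [|i _|[i y] [i' y'] _ _ [-> ->] //].
    exact: enum_uniq.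
  by rewrite /= mem_enum !inE eqxx enum_uniq.
by apply/hasPn => _ /mapP[v _ ->]; apply/negP => /allpairsPdep[i [y []]].
Qed.

Lemma mem_kautz_enum : kautz_enum =i kautz_support s V.
Proof.
case=> [[i y]|v]; rewrite mem_cat.
  rewrite [X in _ || X](_ : _ = false) ?orbF; last by apply/mapP => -[].
  apply/allpairsPdep/idP => [[i' [y' [_ y'L [-> ->]]]]|yt].
    move: y'L; rewrite inE mem_enum !inE.
    by case/orP => [/eqP->|/andP[_ //]]; apply: Y_top.
  exists i, y; split=> //; first by rewrite mem_enum.
  by rewrite inE mem_enum !inE; case: eqP => //= _; apply: yt.
rewrite [X in X || _](_ : _ = false);
  last by apply/negbTE/negP => /allpairsPdep[i [y []]].
by rewrite mem_map ?mem_enum // => ? ? [].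
Qed.

Lemma map_kautz_enum (r : kautz_index n d k -> nat) :
  (forall iy, r (inl iy) = top_order d Y 0 iy) ->
  (forall v, v \in V -> r (inr v) * kautz_c d m v = kautz_exponent (inr v :
    kautz_index n d k)) ->
  map r kautz_enum = kautz_orders V.
Proof.
move=> rl rV; rewrite map_cat /kautz_orders; congr (_ ++ _); last first.
  rewrite -map_comp; apply/eq_in_map => v; rewrite mem_enum => vV /=.
  rewrite /kautz_orbit_order -[absz _]/(kautz_exponent (inr v : kautz_index n d
    k)).
  by rewrite -rV // mulnK // kautz_c_gt0 ?kautz_n_gt0 ?kautz_coprime.
rewrite map_flatten -map_comp -val_enum_ord -[in RHS]map_comp; congr flatten.
apply: eq_map => i /=; rewrite rl /top_order /= eqxx; congr cons.
rewrite -map_comp.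
have -> : kautz_n n d i + kautz_n n d i.+2 - (2 * kautz_n n d i.+1 + 1) =
    size (enum ([set y | chain_top d s i y] :\ Y i)).
  have := cardsD1 (Y i) [set y | chain_top d s i y].
  rewrite inE Y_top (card_top n_gt0 sP (ltn_ord i)) -cardE => E.
  by rewrite subnDA E add1n subn1.
rewrite -(size_map (r \o (fun y => inl (i, y)))).
apply/all_pred1P/allP => _ /mapP[y yL ->]; move: yL.
rewrite mem_enum !inE => /andP[/negPf yY _] /=.
by rewrite rl /top_order /= yY.
Qed.

End Enumeration.

Theorem theorem3p2 (n d k : nat) (V : {set 'I_(kautz_n n d k)})
    (n_gt0 : 0 < n) (d_gt0 : 0 < d)
    (g_k : kautz_g n d k = 1)
    (k_min : forall j : nat, j < k -> kautz_g n d j <> 1)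
    (V_reps : orbit_representatives d V)
    (V_prime_powers : contains_prime_power_quotients V) :
  zmod_isomorphic (critical_group (kautz n d)) (sum_Z (kautz_orders V)) /\
  (forall v : 'I_n,
     zmod_isomorphic (sandpile_group (kautz n d) v) (sum_Z (kautz_orders V))).
Proof.
have [s sP] := deep_section_exists d n_gt0 k.
have g_gt1 (i : 'I_k) : 1 < kautz_g n d i.
  by rewrite ltn_neqAle kautz_g_gt0 // andbT eq_sym; apply/eqP/k_min.
have Y_exists (i : 'I_k) : exists y, chain_top d s i y /\ exists2 z : int,
    weight (kautz_generator n_gt0 s (inl (i, y) : kautz_index n d k)) =
      (z * (kautz_n n d i.+1)%:Z)%R & coprimez (kautz_g n d i) z.
  by have [y y_top yw] := full_order_generator n_gt0 g_k sP V (g_gt1 i); exists y.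
have [Y YP] := choice Y_exists.
have Y_top i := (YP i).1; have Y_weight i := (YP i).2.
have [f [r [dec fl rl rC wf]]] := prime_stage_full n_gt0 g_k sP V_reps
  V_prime_powers.
have fV v : v \in V -> (n %| weight (f (inr v)))%Z.
  move=> vV; have [decM _ _] := dec.
  have nE := kautz_n_gcd d n_gt0 k.
  rewrite -[X in (Posz X %| _)%Z]nE PoszM Gauss_dvdz; last first.
    by rewrite coprimezE !absz_nat coprime_gcd_exp.
  rewrite (decM (inr v)) //=; have := wf v vV.
  rewrite -[X in X %/ _]nE mulKn ?kautz_n_gt0 // rpredBr // dvdzE !absz_nat.
  by rewrite mulnCA dvdn_mulr.
have rl' (iy : 'I_k * 'I_n) : r (inl iy) = d ^ iy.1.+1 by rewrite rl; case: iy.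
have [f' [r' [dec' _ r'l _ r'r]]] :=
  level_stages sP Y_top Y_weight dec fl rl' fV (leqnn k).
rewrite subnn in dec' r'l.
have [f2 dec2] := kautz_decomposition dec'.
have rE : map r' (kautz_enum s V Y) = kautz_orders V.
  apply: map_kautz_enum => // v vV.
  by rewrite r'r rC.
have rowsum := laplacian_kautz_row_sum d n_gt0.
have uts := kautz_enum_uniq s V Y.
have mts := mem_kautz_enum V Y_top.
rewrite -rE; split=> [|v].
  exact: critical_group_decomposition rowsum uts mts dec2.
exact: sandpile_group_decomposition rowsum uts mts dec2.
Qed.
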